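(* Let $\mathcal{A}$ be a $\rho$-replicable algorithm taking $m$ samples from a distribution $\mathcal{D}$ over $\mathbb{R}^d$ such that if $\mathcal{D}=\mathcal{N}(0,I)$ it outputs accept with probability at least $0.99$, and if $\mathcal{D}=\mathcal{N}(\mu,I)$ with $\|\mu\|_2\ge\alpha$ it outputs reject with probability at least $0.99$. Then $m=\Omega\left(\frac{\sqrt{d}}{\alpha^2\rho}+\frac{1}{\alpha^2\rho^2}\right)$ in the worst case.
   Context: $\mathcal{A}(X;r)$ is $\rho$-replicable if for every distribution $\mathcal{D}$ on $\mathbb{R}^d$, $\Pr_{X,X'\sim\mathcal{D}^{\otimes m},r}[\mathcal{A}(X;r)=\mathcal{A}(X';r)]\ge1-\rho$, with $X,X'$ independent and shared internal randomness $r$. *)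

(* Defs.v *)
From HB Require Import structures.
From mathcomp Require Import all_boot all_order all_algebra.
From mathcomp Require Import all_classical all_reals all_analysis.

Set Implicit Arguments.
Unset Strict Implicit.
Unset Printing Implicit Defensive.

Import Order.TTheory GRing.Theory Num.Theory.
Import numFieldNormedType.Exports.

Local Open Scope classical_set_scope.
Local Open Scope ring_scope.

Section tuple_prob.
Context d (T : measurableType d) (R : realType).

Definition tuple_cons n (x : T * n.-tuple T) : n.+1.-tuple T :=
  [tuple of x.1 :: x.2].

Lemma measurable_tuple_cons n : measurable_fun setT (@tuple_cons n).
Proof. exact: measurable_cons. Qed.

HB.instance Definition _ n :=
  isMeasurableFun.Build _ _ _ _ (@tuple_cons n) (@measurable_tuple_cons n).

(* [tuple_prob P] is the law of a tuple of independent coordinates, the i-th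
   one having law [P i], on the product sigma-algebra of [n.-tuple T]. *)
Fixpoint tuple_prob n : ('I_n -> probability T R) -> probability (n.-tuple T) R :=
  match n with
  | 0 => fun _ => \d_ [tuple]
  | n.+1 => fun P =>
      distribution (P ord0 \x tuple_prob (fun i => P (lift ord0 i)))%E
                   (@tuple_cons n)
  end.

Definition iid_prob n (P : probability T R) : probability (n.-tuple T) R :=
  tuple_prob (fun _ : 'I_n => P).

End tuple_prob.

(* R^d; the measurable structure on tuples is the product one, so over
   [measurableTypeR R] it is the Borel sigma-algebra of R^d. *)
Notation vec R d := (d.-tuple (measurableTypeR R)).

Section gaussian.
Context (R : realType) (d : nat).

Definition l2norm (x : vec R d) : R :=
  Num.sqrt (\sum_(i < d) (tnth x i : R) ^+ 2).

(* [gaussian mu] is N(mu, I): independent coordinates, the i-th one being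
   N(mu_i, 1). *)
Definition gaussian (mu : vec R d) : probability (vec R d) R :=
  tuple_prob (fun i =>
    normal_prob (tnth mu i : R) 1 : probability (measurableTypeR R) R).

Definition origin : vec R d := [tuple of nseq d (0 : R)].

End gaussian.

Section algorithms.
Context (R : realType) (d m : nat).
Context dOm (Om : measurableType dOm) (Q : probability Om R).

(* An algorithm is a measurable function of the m samples in R^d and of the
   internal randomness, drawn from [Q] independently of the samples. *)
Definition algorithm dY (Y : measurableType dY) :=
  {mfun (m.-tuple (vec R d) * Om)%type >-> Y}.

(* In a point ((X, X'), r) of the probability space below, the two sample
   tuples and the internal randomness are independent; r is used by both runs. *)
Definition replicable dY (Y : measurableType dY) (rho : R)
    (A : algorithm Y) : Prop :=
  forall D : probability (vec R d) R,
    ((1 - rho)%:E <=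
      ((iid_prob m D \x iid_prob m D) \x Q)
        [set z | A (z.1.1, z.2) = A (z.1.2, z.2)])%E.

Definition output_prob dY (Y : measurableType dY) (A : algorithm Y)
    (D : probability (vec R d) R) (y : Y) : \bar R :=
  (iid_prob m D \x Q)%E [set z | A z = y].

End algorithms.

Definition accept : bool := true.
Definition reject : bool := false.

(* Main.v *)
Require Import Defs.
From HB Require Import structures.
From mathcomp Require Import all_boot all_order all_algebra.
From mathcomp Require Import all_classical all_reals all_analysis.
From mathcomp Require Import measurable_realfun.
From mathcomp Require Import ring lra.

(** Fix the internal randomness [r] and let [G mu] be the acceptance probability
on m samples of N(mu, I).  Averaging over [r], replicability says that
[G (1 - G)] has mean at most rho / 2 at every mu.  Along a path from the null
hypothesis to an alternative on which [G] moves by at most 1/5 per step, [G]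
must for most [r] take a value in [2/5, 3/5]; summing [G (1 - G)] over the path
therefore shows that the number of steps is at least a constant over rho.

All continuity estimates come from the Chapman-Robbins inequality, which bounds
squared linear combinations of differences of [G] around mu by [G mu (1 - G mu)]
times a quadratic form in [exp (m <nu - mu, nu' - mu>) - 1].

- A straight segment of length alpha needs about alpha sqrt(m) steps, which
  gives m alpha^2 rho^2 >= c.
- Let the d coordinates of mu be independent, 0 with probability 1 - t and
  +a or -a with probability t / 2 each, where a = alpha / sqrt d.  As t goes
  from 0 to 1 the mean of [G mu] moves at speed at most sqrt d m a^2 / 2: its
  derivative is the mean of a sum of d second differences, which are orthogonal
  in the Chapman-Robbins form.  When m a^2 is small, Efron-Stein together with
  Chapman-Robbins for first differences shows that the variance of [G mu] over
  this prior is at most half the mean of [G mu (1 - G mu)], so the latter is at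
  least 2/3 of [p (1 - p)] for the mean [p].  Hence sqrt d <= C m alpha^2 rho.
  When m a^2 is large, the first bound implies the second. *)

Set Implicit Arguments.
Unset Strict Implicit.
Unset Printing Implicit Defensive.

Import Order.TTheory GRing.Theory Num.Theory.
Import numFieldNormedType.Exports.

Local Open Scope classical_set_scope.
Local Open Scope ring_scope.

(** * Densities of product measures *)

Section has_density.
Context d (T : measurableType d) (R : realType).

(** A Radon-Nikodym density in the form of a change of variables for nonnegative functions, the form
    that iterates under Tonelli's theorem. *)
Definition has_density (P' P : probability T R) (f : T -> R) : Prop :=
  [/\ measurable_fun setT f, (forall x, 0 <= f x) &
      forall g : T -> \bar R, measurable_fun setT g -> (forall x, 0 <= g x)%E ->
        (\int[P']_x g x = \int[P]_x (g x * (f x)%:E))%E].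

End has_density.

(** The Radon-Nikodym derivative and [normal_pdf] have equal integrals over every measurable set,
    hence agree almost everywhere. *)
Lemma ge0_integral_normal_prob (R : realType) (m : R)
    (g : measurableTypeR R -> \bar R) :
  measurable_fun setT g -> (forall x, 0 <= g x)%E ->
  (\int[normal_prob m 1]_x g x =
   \int[lebesgue_measure]_x (g x * (normal_pdf m 1 x)%:E))%E.
Proof.
move=> mg g0.
have dom := normal_prob_dominates m (1 : R).
rewrite -(Radon_Nikodym_SigmaFinite.change_of_variables dom)//.
apply: ae_eq_integral => //.
- apply: emeasurable_funM => //.
  exact: measurable_int (Radon_Nikodym_SigmaFinite.f_integrable dom).
- apply: emeasurable_funM => //.
  by apply/measurable_EFinP; exact: measurable_normal_pdf.
- apply: ae_eqe_mul2l.
  apply: integral_ae_eq => //.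
  + exact: Radon_Nikodym_SigmaFinite.f_integrable.
  + by apply/measurable_EFinP; exact: measurable_normal_pdf.
  + by move=> E _ mE; rewrite -Radon_Nikodym_SigmaFinite.f_integral.
Qed.

(** The likelihood ratio of N(nu, 1) against N(mu, 1) at [x]. *)
Definition shift_ratio (R : realType) (mu nu x : R) : R :=
  expR ((nu - mu) * (x - mu) - (nu - mu) ^+ 2 / 2).

Lemma measurable_shift_ratio (R : realType) (mu nu : R) :
  measurable_fun setT (shift_ratio mu nu : measurableTypeR R -> R).
Proof.
apply: measurableT_comp => //.
apply: measurable_funB => //.
apply: measurable_funM => //.
exact: measurable_funB.
Qed.

Lemma has_density_normal (R : realType) (mu nu : R) :
  @has_density _ (measurableTypeR R) R (normal_prob nu 1) (normal_prob mu 1)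
    (shift_ratio mu nu).
Proof.
split; [exact: measurable_shift_ratio|by move=> x; exact: expR_ge0|].
move=> g mg g0.
rewrite !ge0_integral_normal_prob//; last 2 first.
- apply: emeasurable_funM => //; apply/measurable_EFinP.
  exact: measurable_shift_ratio.
- by move=> x; rewrite mule_ge0// lee_fin expR_ge0.
apply: eq_integral => x _; rewrite -muleA -EFinM; congr (_ * _%:E)%E.
rewrite !normal_pdfE ?oner_neq0// /normal_fun mulrCA -expRD.
congr (_ * expR _).
by field.
Qed.

Section tuple_density.
Context d (T : measurableType d) (R : realType).

Lemma measurable_prod_tnth n (f : 'I_n -> T -> R) :
  (forall i, measurable_fun setT (f i)) ->
  measurable_fun setT (fun x : n.-tuple T => \prod_i f i (tnth x i)).
Proof.
move=> mf; apply: measurable_prod => i _.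
by apply: (measurableT_comp (mf i)); exact: measurable_tnth.
Qed.

(** Induction on [n]: Tonelli splits off the first coordinate, the induction hypothesis changes the
    inner measure, and the density of the first coordinate changes the outer one. *)
Lemma has_density_tuple_prob n (P' P : 'I_n -> probability T R)
    (f : 'I_n -> T -> R) :
  (forall i, has_density (P' i) (P i) (f i)) ->
  has_density (tuple_prob P') (tuple_prob P)
    (fun x => \prod_i f i (tnth x i)).
Proof.
move=> hf; split.
- by apply: measurable_prod_tnth => i; case: (hf i).
- by move=> x; apply: prodr_ge0 => i _; case: (hf i).
elim: n P' P f hf => [|n IH] P' P f hf g mg g0.
  by apply: eq_integral => x _; rewrite big_ord0 mule1.
have [mf0 f00 hf0] := hf ord0.
have mF : measurable_fun setT
    (fun x : n.-tuple T => \prod_i f (lift ord0 i) (tnth x i)).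
  apply: (measurable_prod_tnth (f := fun i => f (lift ord0 i))) => i.
  by case: (hf (lift ord0 i)).
have F0 (x : n.-tuple T) : 0 <= \prod_i f (lift ord0 i) (tnth x i).
  by apply: prodr_ge0 => i _; case: (hf (lift ord0 i)).
have mf : measurable_fun setT
    (fun x : n.+1.-tuple T => \prod_i f i (tnth x i)).
  by apply: measurable_prod_tnth => i; case: (hf i).
have f0 (x : n.+1.-tuple T) : 0 <= \prod_i f i (tnth x i).
  by apply: prodr_ge0 => i _; case: (hf i).
have mgc : measurable_fun setT (g \o @tuple_cons _ T n).
  by apply: measurableT_comp => //; exact: measurable_tuple_cons.
rewrite /= !ge0_integral_distribution//; last 2 first.
- by apply: emeasurable_funM => //; exact/measurable_EFinP.
- by move=> y; rewrite mule_ge0// lee_fin.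
pose F' := fun x : T * n.-tuple T =>
  (g (tuple_cons x) * (\prod_i f (lift ord0 i) (tnth x.2 i))%:E)%E.
have mF' : measurable_fun setT F'.
  apply: emeasurable_funM => //; apply/measurable_EFinP.
  exact: measurableT_comp mF measurable_snd.
have F'0 x : (0 <= F' x)%E by rewrite /F' mule_ge0// lee_fin.
rewrite (fubini_tonelli1 (g \o @tuple_cons _ T n))//; last by move=> x /=.
rewrite /fubini_F.
transitivity (\int[P' ord0]_x
    \int[tuple_prob (fun i => P (lift ord0 i))]_y F' (x, y))%E.
  apply: eq_integral => x _.
  rewrite (IH _ (fun i => P (lift ord0 i)) (fun i => f (lift ord0 i)))//.
    exact: measurableT_comp mgc (measurable_pair1 x).
  by move=> y /=.
pose H x := (\int[tuple_prob (fun i => P (lift ord0 i))]_y F' (x, y))%E.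
transitivity (\int[P ord0]_x (H x * (f ord0 x)%:E))%E.
  apply: (hf0 H); first exact: (measurable_fun_fubini_tonelli_F F').
  by move=> x; apply: integral_ge0.
rewrite fubini_tonelli1; last 2 first.
- apply: emeasurable_funM => //; apply/measurable_EFinP.
  by apply: (measurableT_comp mf); exact: measurable_tuple_cons.
- by move=> x /=; rewrite mule_ge0// lee_fin.
apply: eq_integral => x _; rewrite /fubini_F muleC -ge0_integralZl//; last 2 first.
- exact: measurableT_comp mF' (measurable_pair1 x).
- by rewrite lee_fin.
apply: eq_integral => y _.
rewrite /F' muleCA /= -EFinM big_ord_recl; congr (_ * (_ * _)%:E)%E.
by apply: eq_bigr => i _; congr (f _ _); rewrite /tuple_cons/= (tnthS x y).
Qed.

End tuple_density.

(** * The Chapman-Robbins inequality *)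

Lemma discriminant_le0 (F : realFieldType) (a b c : F) :
  (forall s, 0 <= s ^+ 2 * a + s * b *+ 2 + c) -> b ^+ 2 <= a * c.
Proof.
move=> h.
have c0 : 0 <= c by have := h 0; rewrite expr0n/= !mul0r mul0rn !add0r.
have [a0|a0|a0] := ltgtP a 0.
- exfalso.
  (* Chosen so that [s >= 1] and [s * a + 2 * b < - (c + 1)], which makes the quadratic negative. *)
  pose s := (`|b| *+ 2 + c + 1) / (- a) + 1.
  have a0' : 0 < - a by rewrite oppr_gt0.
  have hs : s * a = - (`|b| *+ 2 + c + 1) + a.
    by rewrite /s; field; rewrite lt_eqF.
  have s1 : 1 <= s.
    rewrite /s lerDr divr_ge0 ?(ltW a0')// !addr_ge0// mulrn_wge0//.
  have := h s.
  have bb : b <= `|b| by exact: ler_norm.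
  have b0 : 0 <= `|b| by [].
  rewrite expr2 -mulrA hs.
  have : s * b <= s * `|b| by rewrite ler_wpM2l// (le_trans _ s1).
  nra.
(* The minimiser of the quadratic. *)
- have := h (- b / a).
  have -> : (- b / a) ^+ 2 * a + (- b / a) * b *+ 2 + c = (a * c - b ^+ 2) / a.
    by field; rewrite gt_eqF.
  by rewrite pmulr_lge0 ?invr_gt0// subr_ge0.
- have [->|b0] := eqVneq b 0; first by rewrite expr0n/= mulr_ge0// a0.
  (* With [a = 0] the function is affine in [s], and it is negative at this point. *)
  exfalso; have := h (- (c + 1) / b).
  have -> : (- (c + 1) / b) ^+ 2 * a + - (c + 1) / b * b *+ 2 + c = - c - 2.
    by rewrite a0; field.
  lra.
Qed.

Section Rintegral_sum.
Context d (T : measurableType d) (R : realType) (P : {measure set T -> \bar R}).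

Lemma integrable_Rintegral_sum (I : Type) (s : seq I) (f : I -> T -> R) :
  (forall i, P.-integrable setT (EFin \o f i)) ->
  P.-integrable setT (EFin \o (fun x => \sum_(i <- s) f i x)) /\
  \int[P]_x (\sum_(i <- s) f i x) = \sum_(i <- s) \int[P]_x f i x.
Proof.
move=> fi; elim: s => [|i s [IH1 IH2]].
  split.
    rewrite (_ : _ \o _ = cst 0%E); first exact: integrable0.
    by apply/funext => x /=; rewrite big_nil.
  rewrite big_nil (_ : (fun x => _) = cst 0); first by rewrite Rintegral_cst// mul0r.
  by apply/funext => x; rewrite big_nil.
split.
  rewrite (_ : _ \o _ =
      ((EFin \o f i) \+ (EFin \o (fun x => (\sum_(j <- s) f j x)%R)))%E).
    exact: integrableD.
  by apply/funext => x /=; rewrite big_cons EFinD.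
rewrite big_cons -IH2 -RintegralD//.
by apply: eq_Rintegral => x _; rewrite big_cons.
Qed.

(** The double sum is the integral of the square of [\sum_a c a * u a]. *)
Lemma gram_ge0 (J : finType) (u : J -> T -> R) (c : J -> R) :
  (forall a b, P.-integrable setT (EFin \o (fun x => u a x * u b x))) ->
  0 <= \sum_a \sum_b c a * c b * \int[P]_x (u a x * u b x).
Proof.
move=> ui.
have ui' (p : J * J) : P.-integrable setT
    (EFin \o (fun x => c p.1 * c p.2 * (u p.1 x * u p.2 x))).
  pose f x : R := u p.1 x * u p.2 x.
  rewrite (_ : _ \o _ = (fun x => (c p.1 * c p.2)%:E * (EFin \o f) x)%E)//.
  by apply: integrableZl => //; exact: ui.
rewrite pair_bigA/=.
under eq_bigr do rewrite -RintegralZl//.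
rewrite -(integrable_Rintegral_sum _ ui').2.
apply: Rintegral_ge0 => x _.
rewrite -(pair_bigA _ (fun a b => c a * c b * (u a x * u b x)))/=.
under eq_bigr => a _.
  under eq_bigr => b _ do rewrite mulrACA.
  rewrite -mulr_sumr.
  over.
by rewrite -mulr_suml -expr2 sqr_ge0.
Qed.

End Rintegral_sum.

Section chapman_robbins.
Context d (T : measurableType d) (R : realType).
Implicit Types P : probability T R.

Lemma has_density_indic P' P (f : T -> R) (S : set T) :
  has_density P' P f -> measurable S ->
  (\int[P]_x (\1_S x * f x)%:E = P' S)%E.
Proof.
move=> [_ _ h] mS.
have := h (EFin \o \1_S); rewrite integral_indic// setIT => ->//.
- exact/measurable_EFinP.
- by move=> x; rewrite lee_fin.
Qed.

Lemma has_density_total P' P (f : T -> R) :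
  has_density P' P f -> (\int[P]_x (f x)%:E = 1)%E.
Proof.
move=> h; rewrite -(probability_setT P') -(has_density_indic h)//.
by apply: eq_integral => x _; rewrite indicT mul1r.
Qed.

Lemma integrable_of_ge0 P (f : T -> R) (r : R) :
  measurable_fun setT f -> (forall x, 0 <= f x) ->
  (\int[P]_x (f x)%:E = r%:E)%E -> P.-integrable setT (EFin \o f).
Proof.
move=> mf f0 fr; apply/integrableP; split; first exact/measurable_EFinP.
under eq_integral do rewrite /= ger0_norm//.
by rewrite fr ltry.
Qed.

(** Each [L k] has mean 1 under [P], so the sum on the left is the covariance of the indicator of
    [S] with [\sum_k c k * (L k - 1)]. Cauchy-Schwarz bounds its square by the product of the two
    variances; [K k l - 1] is the covariance of [L k] and [L l]. *)
Lemma chapman_robbins P (I : finType) (P' : I -> probability T R)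
    (L : I -> T -> R) (K : I -> I -> R) (c : I -> R) (S : set T) :
  (forall k, has_density (P' k) P (L k)) ->
  (forall k l, \int[P]_x (L k x * L l x)%:E = (K k l)%:E)%E ->
  measurable S ->
  (\sum_k c k * (fine (P' k S) - fine (P S))) ^+ 2 <=
  fine (P S) * (1 - fine (P S)) *
  \sum_k \sum_l c k * c l * (K k l - 1).
Proof.
move=> hL hK mS; set G := fine (P S).
(* [inl true] stands for the indicator of [S], [inl false] for the constant 1, [inr k] for [L k];
   [g] is their Gram matrix under [P]. *)
pose u (a : bool + I) : T -> R :=
  match a with inl true => \1_S | inl false => cst 1 | inr k => L k end.
pose g (a b : bool + I) : R := match a, b with
  | inl e, inl e' => if e || e' then G else 1
  | inl e, inr k | inr k, inl e => if e then fine (P' k S) else 1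
  | inr k, inr l => K k l
  end.
have mu_ a : measurable_fun setT (u a).
  case: a => [[]|k] /=; [exact: measurable_indic|exact: measurable_cst|].
  by case: (hL k).
have u0 a x : 0 <= u a x by case: a => [[]|k] //=; by case: (hL k).
have PE (p : probability T R) : (p S = (fine (p S))%:E)%E.
  by rewrite fineK// fin_num_measure.
have gE a b : (\int[P]_x (u a x * u b x)%:E = (g a b)%:E)%E.
  have EP : (\int[P]_x (\1_S x)%:E = G%:E)%E.
    by rewrite integral_indic// setIT; exact: PE.
  have E1 : (\int[P]_x 1%:E = 1%:E :> \bar R)%E.
    by rewrite integral_cst//= mul1e; exact: probability_setT.
  case: a => [[]|k]; case: b => [[]|l] /=.
  - rewrite -EP; apply: eq_integral => x _.
    by rewrite indicE -natrM mulnb andbb.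
  - by rewrite -EP; apply: eq_integral => x _; rewrite mulr1.
  - by rewrite (has_density_indic (hL _)).
  - by rewrite -EP; apply: eq_integral => x _; rewrite mul1r.
  - by rewrite -[RHS]E1; apply: eq_integral => x _; rewrite mul1r.
  - rewrite -(has_density_total (hL l)).
    by apply: eq_integral => x _; rewrite mul1r.
  - under eq_integral do rewrite mulrC.
    by rewrite (has_density_indic (hL _)).
  - rewrite -(has_density_total (hL k)).
    by apply: eq_integral => x _; rewrite mulr1.
  - by rewrite hK.
set C := \sum_k c k.
have -> : \sum_k \sum_l c k * c l * (K k l - 1) =
    \sum_k \sum_l c k * c l * g (inr k) (inr l) - C ^+ 2.
  rewrite expr2 {1}/C mulr_suml -sumrB; apply: eq_bigr => k _.
  rewrite mulr_sumr -sumrB; apply: eq_bigr => l _.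
  by rewrite mulrBr mulr1.
have -> : \sum_k c k * (fine (P' k S) - G) =
    \sum_k c k * fine (P' k S) - C * G.
  by rewrite mulr_suml -sumrB; apply: eq_bigr => k _; rewrite mulrBr.
apply: discriminant_le0 => s.
(* the Gram inequality for [s * (1_S - G) + \sum_k c k * (L k - 1)] *)
pose x (a : bool + I) : R :=
  match a with inl true => s | inl false => - (s * G + C) | inr k => c k end.
have ui a b : (P).-integrable setT (EFin \o (fun x => u a x * u b x)).
  apply: (@integrable_of_ge0 P _ (g a b)) => //.
  - exact: measurable_funM.
  - by move=> y; rewrite mulr_ge0.
have := gram_ge0 x ui.
under eq_bigr do under eq_bigr do rewrite /Rintegral gE /=.
rewrite !big_sumType/= !big_bool/= !big_sumType/= !big_bool/=.
under [X in 0 <= _ + X -> _]eq_bigr do rewrite big_sumType/= big_bool/=.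
rewrite !big_split/=.
set D := \sum_k \sum_l _.
have -> : \sum_i s * c i * fine (P' i S) = s * \sum_i c i * fine (P' i S).
  by rewrite mulr_sumr; apply: eq_bigr => i _; rewrite mulrA.
have -> : \sum_i - (s * G + C) * c i * 1 = - (s * G + C) * C.
  by rewrite mulr_sumr; apply: eq_bigr => i _; rewrite mulr1.
have -> : \sum_i c i * s * fine (P' i S) = s * \sum_i c i * fine (P' i S).
  by rewrite mulr_sumr; apply: eq_bigr => i _; rewrite mulrA [s * _]mulrC.
have -> : \sum_i c i * - (s * G + C) * 1 = - (s * G + C) * C.
  by rewrite mulr_sumr; apply: eq_bigr => i _; rewrite mulr1 mulrC.
set Z := \sum_i _.
move=> h; apply: le_trans h _; rewrite le_eqVlt; apply/orP; left; apply/eqP.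
ring.
Qed.

End chapman_robbins.

(** * Likelihood ratios of Gaussian samples *)

Section gaussian_likelihood.
Context (R : realType) (d m : nat).
Implicit Types mu nu : vec R d.

Definition likelihood_ratio mu nu (x : m.-tuple (vec R d)) : R :=
  \prod_j \prod_i shift_ratio (tnth mu i) (tnth nu i) (tnth (tnth x j) i).

Lemma has_density_gaussian mu nu :
  has_density (gaussian nu) (gaussian mu)
    (fun x => \prod_i shift_ratio (tnth mu i) (tnth nu i) (tnth x i)).
Proof.
exact: (@has_density_tuple_prob _ (measurableTypeR R) R d
  (fun i => normal_prob (tnth nu i : R) 1) (fun i => normal_prob (tnth mu i : R) 1)
  _ (fun i => has_density_normal (tnth mu i : R) (tnth nu i))).
Qed.

Lemma has_density_iid_gaussian mu nu :
  has_density (iid_prob m (gaussian nu)) (iid_prob m (gaussian mu))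
    (likelihood_ratio mu nu).
Proof.
exact: (@has_density_tuple_prob _ (vec R d) R m (fun=> gaussian nu)
  (fun=> gaussian mu) _ (fun=> has_density_gaussian mu nu)).
Qed.

Definition inner_at mu nu nu' : R :=
  \sum_i ((tnth nu i : R) - tnth mu i) * ((tnth nu' i : R) - tnth mu i).

(** Completing the square: the product is a constant times the likelihood ratio for the mean
    [nu + nu' - mu]. As that ratio integrates to 1, the constant is the integral of the product. *)
Lemma likelihood_ratioM mu nu nu' x :
  likelihood_ratio mu nu x * likelihood_ratio mu nu' x =
  expR (m%:R * inner_at mu nu nu') *
  likelihood_ratio mu
    [tuple ((tnth nu i : R) + tnth nu' i - tnth mu i : measurableTypeR R) | i < d] x.
Proof.
rewrite /likelihood_ratio -big_split/=.
have -> : expR (m%:R * inner_at mu nu nu') =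
    \prod_(j < m) \prod_(i < d)
      expR (((tnth nu i : R) - tnth mu i) * ((tnth nu' i : R) - tnth mu i)).
  by rewrite -expR_sum prodr_const card_ord -expRM_natl.
rewrite -big_split/=; apply: eq_bigr => j _.
rewrite -!big_split/=; apply: eq_bigr => i _.
rewrite tnth_mktuple /shift_ratio -!expRD; congr expR.
by field.
Qed.

Lemma integral_likelihood_ratioM mu nu nu' :
  (\int[iid_prob m (gaussian mu)]_x
     (likelihood_ratio mu nu x * likelihood_ratio mu nu' x)%:E =
   (expR (m%:R * inner_at mu nu nu'))%:E)%E.
Proof.
under eq_integral do rewrite likelihood_ratioM EFinM.
set w := mktuple _.
have [mL L0 _] := has_density_iid_gaussian mu w.
rewrite ge0_integralZl//.
- by rewrite (has_density_total (has_density_iid_gaussian mu w)) mule1.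
- exact/measurable_EFinP.
- by move=> x _; rewrite lee_fin.
Qed.

Lemma chapman_robbins_gaussian (S : set (m.-tuple (vec R d))) (I : finType)
    (nu : I -> vec R d) (c : I -> R) mu :
  measurable S ->
  (\sum_k c k * (fine (iid_prob m (gaussian (nu k)) S) -
                 fine (iid_prob m (gaussian mu) S))) ^+ 2 <=
  fine (iid_prob m (gaussian mu) S) * (1 - fine (iid_prob m (gaussian mu) S)) *
  \sum_k \sum_l c k * c l * (expR (m%:R * inner_at mu (nu k) (nu l)) - 1).
Proof.
move=> mS.
exact: (chapman_robbins (P := iid_prob m (gaussian mu)) c
  (fun k => has_density_iid_gaussian mu (nu k))
  (fun k l => integral_likelihood_ratioM mu (nu k) (nu l)) mS).
Qed.

End gaussian_likelihood.

(** * Finite product weights *)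

Section product_weights.
Context (R : realType) (d : nat) (A : finType).
Implicit Types (v w : {ffun 'I_d -> A}) (q c : A -> R) (i k : 'I_d) (y : A).

Definition update v i y : {ffun 'I_d -> A} :=
  [ffun j => if j == i then y else v j].

Definition weight q v : R := \prod_i q (v i).

Lemma weight_ge0 q v : (forall y, 0 <= q y) -> 0 <= weight q v.
Proof. by move=> q0; apply: prodr_ge0. Qed.

Lemma sum_weight q : \sum_y q y = 1 -> \sum_v weight q v = 1.
Proof.
move=> q1; rewrite -(bigA_distr_bigA (fun _ : 'I_d => q)) /=.
by rewrite big1.
Qed.

Definition swap (S : pred 'I_d) (p : {ffun 'I_d -> A} * {ffun 'I_d -> A}) :
    {ffun 'I_d -> A} * {ffun 'I_d -> A} :=
  ([ffun j => if S j then p.2 j else p.1 j],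
   [ffun j => if S j then p.1 j else p.2 j]).

Lemma swapK S : involutive (swap S).
Proof.
move=> [v w]; rewrite /swap /=.
by congr pair; apply/ffunP => j; rewrite !ffunE; case: (S j).
Qed.

(** The two components are independent copies with product weights, so exchanging them on any set of
    coordinates preserves the joint weight. *)
Lemma sum_swap q S (F : {ffun 'I_d -> A} * {ffun 'I_d -> A} -> R) :
  \sum_p weight q p.1 * weight q p.2 * F p =
  \sum_p weight q p.1 * weight q p.2 * F (swap S p).
Proof.
rewrite (reindex_inj (inv_inj (swapK S))) /=; apply: eq_bigr => -[v w] _ /=.
congr (_ * _); rewrite /weight -!big_split /=; apply: eq_bigr => j _.
by rewrite !ffunE /=; case: ifP => // _; rewrite mulrC.
Qed.

(** Interpolates from [p.1] at [n = 0] to [p.2] at [n = d], one coordinate at a time. *)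
Definition hybrid (n : nat) p := (swap (fun j : 'I_d => (j < n)%N) p).1.

Lemma hybrid0 p : hybrid 0 p = p.1.
Proof. by apply/ffunP => j; rewrite ffunE. Qed.

Lemma hybrid_last p : hybrid d p = p.2.
Proof. by apply/ffunP => j; rewrite ffunE ltn_ord. Qed.

Lemma swap1 i p : (swap (pred1 i) p).1 = update p.1 i (p.2 i).
Proof. by apply/ffunP => j; rewrite !ffunE /=; case: eqP => // ->. Qed.

Lemma hybrid_swap1 i p : hybrid i (swap (pred1 i) p) = hybrid i.+1 p.
Proof.
apply/ffunP => j; rewrite !ffunE /= ltnS (leq_eqVlt j i).
by have [->|] := eqVneq j i; rewrite ?ltnn ?eqxx//= => /negPf; rewrite -val_eqE => ->.
Qed.

Lemma hybridS_swap1 i p : hybrid i.+1 (swap (pred1 i) p) = hybrid i p.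
Proof. by rewrite -hybrid_swap1 swapK. Qed.

(** Written through the swapped pair, a step between hybrids is a resampling of coordinate [i];
    [sum_swap] then turns it into a resampling of [p.1]. *)
Lemma hybridS i p :
  hybrid i.+1 p = update (hybrid i p) i ((swap (fun j => (j < i)%N) p).2 i).
Proof.
apply/ffunP => j; rewrite !ffunE /= ltnn ltnS (leq_eqVlt j i).
have [->|] := eqVneq j i; first by rewrite eqxx.
by move=> /negPf; rewrite -val_eqE /= => ->.
Qed.

(** The variance is the mean of [g p.1 * (g p.1 - g p.2)], which telescopes along the hybrids; each
    increment is then symmetrised by swapping its own coordinate. *)
Lemma efron_stein q (g : {ffun 'I_d -> A} -> R) :
  (forall y, 0 <= q y) -> \sum_y q y = 1 ->
  \sum_v weight q v * g v ^+ 2 - (\sum_v weight q v * g v) ^+ 2 <=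
  2^-1 * \sum_i \sum_p weight q p.1 * weight q p.2 *
    (g p.1 - g (update p.1 i (p.2 i))) ^+ 2.
Proof.
move=> q0 q1.
pose E F := \sum_p weight q p.1 * weight q p.2 * F p : R.
have EB F G : E (fun p => F p - G p) = E F - E G.
  by rewrite -sumrB; apply: eq_bigr => p _; rewrite mulrBr.
have Ele F G : (forall p, F p <= G p) -> E F <= E G.
  by move=> FG; apply: ler_sum => p _; rewrite ler_wpM2l// mulr_ge0// weight_ge0.
have Esplit (F G : {ffun 'I_d -> A} -> R) :
    E (fun p => F p.1 * G p.2) =
    (\sum_v weight q v * F v) * (\sum_v weight q v * G v).
  rewrite mulr_suml /E -(pair_bigA _ (fun v w =>
    weight q v * weight q w * (F v * G w)))/=.
  apply: eq_bigr => v _; rewrite mulr_sumr; apply: eq_bigr => w _.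
  by rewrite mulrACA.
have -> : \sum_v weight q v * g v ^+ 2 - (\sum_v weight q v * g v) ^+ 2 =
    \sum_(i < d) E (fun p => g p.1 * (g (hybrid i p) - g (hybrid i.+1 p))).
  transitivity (E (fun p => g p.1 * (g p.1 - g p.2))).
    transitivity (E (fun p => g p.1 ^+ 2 * 1 - g p.1 * g p.2)).
      rewrite EB (Esplit (fun v => g v ^+ 2) (fun=> 1)) Esplit expr2.
      by under [X in _ = _ * X - _]eq_bigr do rewrite mulr1; rewrite sum_weight ?mulr1.
    by apply: eq_bigr => p _; congr (_ * _); ring.
  rewrite exchange_big /=; apply: eq_bigr => p _.
  rewrite -mulr_sumr -mulr_sumr; congr (_ * (_ * _)).
  rewrite -(big_mkord xpredT (fun n => g (hybrid n p) - g (hybrid n.+1 p))).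
  rewrite (@telescope_sumr_eq _ 0 d (fun n => - g (hybrid n p)))//.
    by rewrite hybrid0 hybrid_last opprK addrC.
  by move=> n _; rewrite opprK addrC.
rewrite mulr_sumr; apply: ler_sum => i _.
pose D (p : {ffun 'I_d -> A} * {ffun 'I_d -> A}) := g p.1 - g (update p.1 i (p.2 i)).
pose H p := g (hybrid i p) - g (hybrid i.+1 p).
(* Swapping the coordinates below [i] turns [D] into [H], so their second moments agree. *)
have EH : E (fun p => H p ^+ 2) = E (fun p => D p ^+ 2).
  rewrite [RHS](sum_swap q (fun j => (j < i)%N)).
  by apply: eq_bigr => p _; rewrite /H hybridS.
(* Swapping coordinate [i] alone changes the sign of [H] and replaces [p.1] by its update; averaging
   both expressions gives the factor 1/2. *)
have ED : E (fun p => g p.1 * H p) = 2^-1 * E (fun p => D p * H p).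
  have e : E (fun p => g p.1 * H p) =
      - E (fun p => g (update p.1 i (p.2 i)) * H p).
    rewrite {1}/E (sum_swap q (pred1 i)) -sumrN; apply: eq_bigr => p _.
    by rewrite swap1 /H hybrid_swap1 hybridS_swap1 -mulrN -mulrN opprB.
  have : E (fun p => D p * H p) = E (fun p => g p.1 * H p) -
      E (fun p => g (update p.1 i (p.2 i)) * H p).
    by rewrite -EB; apply: eq_bigr => p _; rewrite mulrBl.
  lra.
have : E (fun p => D p * H p) <= E (fun p => 2^-1 * (D p ^+ 2 + H p ^+ 2)).
  by apply: Ele => p; have := sqr_ge0 (D p - H p); lra.
have -> : E (fun p => 2^-1 * (D p ^+ 2 + H p ^+ 2)) =
    2^-1 * (E (fun p => D p ^+ 2) + E (fun p => H p ^+ 2)).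
  by rewrite -big_split mulr_sumr; apply: eq_bigr => p _ /=; ring.
rewrite EH -/(E _) -/(E (fun p => D p ^+ 2)) ED; lra.
Qed.

(** Exchanging [v i] with the fresh value [y] gives coordinate [i] the signed weight [c]; the old
    value then carries [q] and sums out to 1. *)
Lemma sum_update q c i (g : {ffun 'I_d -> A} -> R) :
  \sum_y q y = 1 ->
  \sum_v weight q v * \sum_y c y * g (update v i y) =
  \sum_(v : {ffun 'I_d -> A}) (\prod_j (if j == i then c (v j) else q (v j))) * g v.
Proof.
move=> q1.
pose f (p : {ffun 'I_d -> A} * A) := (update p.1 i p.2, p.1 i).
have fK : involutive f.
  move=> [v y]; rewrite /f /=; congr pair; last by rewrite ffunE eqxx.
  by apply/ffunP => j; rewrite !ffunE; case: eqP => // ->.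
have updE (h : A -> R) (v : {ffun 'I_d -> A}) : \prod_j (if j == i then h (v j) else q (v j)) =
    h (v i) * \prod_(j | j != i) q (v j).
  rewrite (bigD1 i) //= eqxx; congr (_ * _).
  by apply: eq_bigr => j /negPf ->.
transitivity (\sum_p weight q p.1 * (c p.2 * g (update p.1 i p.2))).
  rewrite -(pair_bigA _ (fun v y => weight q v * (c y * g (update v i y)))) /=.
  by apply: eq_bigr => v _; rewrite mulr_sumr.
rewrite (reindex_inj (inv_inj fK)) /=.
rewrite -(pair_bigA _ (fun v y => weight q (update v i y) *
  (c (v i) * g (update (update v i y) i (v i))))) /=.
apply: eq_bigr => v _.
transitivity (\sum_y q y * ((\prod_j (if j == i then c (v j) else q (v j))) * g v)).
  apply: eq_bigr => y _; rewrite updE.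
  rewrite (_ : update _ i (v i) = v); last first.
    by apply/ffunP => j; rewrite !ffunE; case: eqP => // ->.
  rewrite /weight (bigD1 i) //= ffunE eqxx.
  under eq_bigr => j /negPf ji do rewrite ffunE ji.
  ring.
by rewrite -mulr_suml q1 mul1r.
Qed.

Lemma deriv_prod n (p : 'I_n -> {poly R}) :
  (\prod_i p i)^`() = \sum_i \prod_j (if j == i then (p j)^`() else p j).
Proof.
elim: n p => [|n IH] p; first by rewrite !big_ord0 derivC.
rewrite big_ord_recl derivM IH [RHS]big_ord_recl; congr (_ + _).
  by rewrite big_ord_recl eqxx; congr (_ * _); apply: eq_bigr.
rewrite mulr_sumr; apply: eq_bigr => i _.
by rewrite [RHS]big_ord_recl.
Qed.

(** The mean is a polynomial in the parameter. By the product rule and [sum_update], its derivative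
    is the mean of the sums bounded by [L], and the mean value theorem applies. *)
Lemma mean_lipschitz q c (g : {ffun 'I_d -> A} -> R) (L s t : R) :
  \sum_y q y = 1 -> \sum_y c y = 0 ->
  (forall t y, 0 <= t <= 1 -> 0 <= q y + c y * t) ->
  (forall v, `|\sum_i \sum_y c y * g (update v i y)| <= L) ->
  0 <= s -> s <= t -> t <= 1 ->
  `|\sum_v weight (fun y => q y + c y * t) v * g v -
    \sum_v weight (fun y => q y + c y * s) v * g v| <= L * (t - s).
Proof.
move=> q1 c0 qc gL s0 st t1.
pose p : {poly R} :=
  \sum_(v : {ffun 'I_d -> A}) (\prod_(i < d) ((q (v i))%:P + (c (v i))%:P * 'X)) * (g v)%:P.
have pE x : p.[x] = \sum_v weight (fun y => q y + c y * x) v * g v.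
  rewrite horner_sum; apply: eq_bigr => v _.
  rewrite hornerM hornerC horner_prod; congr (_ * _); apply: eq_bigr => i _.
  by rewrite !hornerE.
have dpE x : p^`().[x] = \sum_v weight (fun y => q y + c y * x) v *
    \sum_i \sum_y c y * g (update v i y).
  transitivity (\sum_(v : {ffun 'I_d -> A}) \sum_i (\prod_j (if j == i then c (v j)
      else q (v j) + c (v j) * x)) * g v).
    rewrite raddf_sum horner_sum; apply: eq_bigr => v _.
    rewrite /= derivM derivC mulr0 addr0 deriv_prod hornerM hornerC horner_sum mulr_suml.
    apply: eq_bigr => i _; congr (_ * _); rewrite horner_prod; apply: eq_bigr => j _.
    case: eqP => _; last by rewrite !hornerE.
    by rewrite derivD derivM !derivC derivX mul0r !add0r mulr1 hornerC.
  rewrite exchange_big /=.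
  under [RHS]eq_bigr do rewrite mulr_sumr.
  rewrite [RHS]exchange_big /=; apply: eq_bigr => i _.
  rewrite (@sum_update (fun y => q y + c y * x))//.
  by rewrite big_split /= -mulr_suml q1 c0 mul0r addr0.
rewrite -!pE.
have [//|x xst ->] := @MVT_segment R (horner p) (horner p^`()) s t st.
  by apply: continuous_subspaceT => x; exact: continuous_horner.
rewrite normrM (ger0_norm (x := t - s)) ?subr_ge0// ler_wpM2r ?subr_ge0//.
have x01 : 0 <= x <= 1.
  by move: xst; rewrite in_itv /= => /andP[? ?]; rewrite (le_trans s0)//= (le_trans _ t1).
rewrite dpE (le_trans (ler_norm_sum _ _ _))//.
have -> : L = \sum_v weight (fun y => q y + c y * x) v * L.
  rewrite -mulr_suml sum_weight ?mul1r//.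
  by rewrite big_split /= -mulr_suml q1 c0 mul0r addr0.
apply: ler_sum => v _; rewrite normrM ger0_norm ?ler_wpM2l//.
- by apply: weight_ge0 => y; exact: qc.
- by apply: weight_ge0 => y; exact: qc.
Qed.

End product_weights.

(** At the first index with [p k <= 3 / 5] the step bound forces [p k >= 2 / 5], and that single
    term is at least 6/25. The left side is nonpositive when the path need not cross, and it is
    affine in [p 0] and [p N], which allows averaging over the randomness. *)
Lemma sum_crossing_ge (R : realFieldType) (p : nat -> R) (N : nat) :
  (forall k, 0 <= p k <= 1) ->
  (forall k, (k < N)%N -> p k - p k.+1 <= 5^-1) ->
  3 / 5 * (p 0 - p N - 3 / 5) <= \sum_(k < N.+1) p k * (1 - p k).
Proof.
move=> p01 step.
have pp k : 0 <= p k * (1 - p k).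
  by have /andP[? ?] := p01 k; rewrite mulr_ge0// subr_ge0.
have sum0 : 0 <= \sum_(k < N.+1) p k * (1 - p k) by apply: sumr_ge0.
have [p0|p0] := ltP (p 0) (3 / 5).
  apply: le_trans sum0; have /andP[? ?] := p01 N; lra.
have [pN|pN] := ltP (2 / 5) (p N).
  apply: le_trans sum0; have /andP[? ?] := p01 0; lra.
have ex : exists k, p k <= 3 / 5 by exists N; lra.
case: (ex_minnP ex) => k pk kmin.
have kN : (k <= N)%N by apply: kmin; lra.
have pk' : 2 / 5 <= p k.
  case: k kN pk kmin => [|k] kN pk kmin; first lra.
  have : 3 / 5 < p k.
    by rewrite ltNge; apply/negP => /kmin; rewrite ltnn.
  have := step k kN; lra.
have kN' : (k < N.+1)%N by [].
rewrite (bigD1 (Ordinal kN')) //= ler_wpDr ?sumr_ge0//.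
have /andP[? ?] := p01 N; have /andP[? ?] := p01 0; nra.
Qed.

(** * Acceptance probabilities along paths of means *)

Lemma expR_le_inv (R : realType) (x : R) : x < 1 -> expR x <= (1 - x)^-1.
Proof.
move=> x1; rewrite -[leLHS]invrK -expRN lef_pV2 ?posrE ?expR_gt0 ?subr_gt0//.
exact: expR_ge1Dx.
Qed.

Section cr_bounded.
Context (R : realType) (d m : nat).

(** All that the path estimates use about an acceptance probability as a function of the mean, for
    fixed internal randomness. *)
Definition cr_bounded (G : vec R d -> R) : Prop :=
  (forall mu, 0 <= G mu <= 1) /\
  forall (I : finType) (nu : I -> vec R d) (c : I -> R) mu,
    (\sum_k c k * (G (nu k) - G mu)) ^+ 2 <=
    G mu * (1 - G mu) *
    \sum_k \sum_l c k * c l * (expR (m%:R * inner_at mu (nu k) (nu l)) - 1).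

Lemma cr_bounded_prob (S : set (m.-tuple (vec R d))) : measurable S ->
  cr_bounded (fun nu => fine (iid_prob m (gaussian nu) S)).
Proof.
move=> mS; split=> [mu|I nu c mu]; last exact: chapman_robbins_gaussian.
rewrite fine_ge0//= -lee_fin fineK ?probability_le1//.
by rewrite fin_num_measure.
Qed.

Variable G : vec R d -> R.
Hypothesis hG : cr_bounded G.

Let G01 mu : 0 <= G mu <= 1. Proof. by case: hG. Qed.

Lemma var_le_quarter mu : 0 <= G mu * (1 - G mu) <= 4^-1.
Proof.
have /andP[g0 g1] := G01 mu; rewrite mulr_ge0 ?subr_ge0//=.
by have := sqr_ge0 (G mu - 2^-1); lra.
Qed.

(** Chapman-Robbins with one point: the squared difference is at most 1/4 times 1/15, which is below
    1/25. *)
Lemma cr_bounded_step mu nu :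
  m%:R * inner_at mu nu nu <= 16^-1 -> G mu - G nu <= 5^-1.
Proof.
move=> h.
have [_ /(_ unit (fun=> nu) (fun=> 1) mu)] := hG.
rewrite !big_const /= !card_unit /= !addr0 !mul1r => hcr.
have e : expR (m%:R * inner_at mu nu nu) - 1 <= 15^-1.
  have h1 : m%:R * inner_at mu nu nu < 1 :> R by apply: le_lt_trans h _; lra.
  have := expR_le_inv h1; rewrite lerBlDr => /le_trans; apply.
  rewrite -div1r ler_pdivrMr ?subr_gt0//.
  by move: (m%:R * _) h {h1 hcr} => X h; lra.
have /andP[v0 v1] := var_le_quarter mu.
rewrite leNgt; apply/negP => gt; nra.
Qed.

Definition axis_point (i0 : 'I_d) (x : R) : vec R d :=
  [tuple (if i == i0 then x else 0 : measurableTypeR R) | i < d].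

Lemma inner_axis_point i0 x y :
  inner_at (axis_point i0 x) (axis_point i0 y) (axis_point i0 y) = (y - x) ^+ 2.
Proof.
rewrite /inner_at (bigD1 i0) //= !tnth_mktuple eqxx -expr2 big1 ?addr0// => i.
by rewrite !tnth_mktuple => /negPf ->; rewrite subrr mul0r.
Qed.

(** Each of the [N] steps has length [alpha / N], and the hypothesis on [N] is exactly the condition
    of [cr_bounded_step]. *)
Lemma axis_path i0 (alpha : R) (N : nat) : (0 < N)%N ->
  16 * (m%:R * alpha ^+ 2) <= N%:R ^+ 2 ->
  3 / 5 * (G (axis_point i0 0) - G (axis_point i0 alpha) - 3 / 5) <=
  \sum_(k < N.+1) G (axis_point i0 (k%:R * (alpha / N%:R))) *
    (1 - G (axis_point i0 (k%:R * (alpha / N%:R)))).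
Proof.
move=> N0 hN; have N0' : 0 < N%:R :> R by rewrite ltr0n.
have := @sum_crossing_ge R (fun k => G (axis_point i0 (k%:R * (alpha / N%:R)))) N.
have -> : N%:R * (alpha / N%:R) = alpha by rewrite mulrC divfK// gt_eqF.
rewrite mul0r; apply=> [k|k kN]; first exact: G01.
apply: cr_bounded_step; rewrite inner_axis_point -mulrBl -natr1 addrAC subrr add0r mul1r.
rewrite expr_div_n mulrA ler_pdivrMr ?exprn_gt0//; lra.
Qed.

(** * Product priors on a three-valued grid *)

Definition grid_coord (y : 'I_3) : R := y%:R - 1.

Definition grid_point (a : R) (v : {ffun 'I_d -> 'I_3}) : vec R d :=
  [tuple (a * grid_coord (v i) : measurableTypeR R) | i < d].

(** Changes in distinct coordinates are orthogonal, so the Chapman-Robbins kernel vanishes off the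
    diagonal [i = j]. *)
Lemma inner_grid_point a v i j y z :
  inner_at (grid_point a v) (grid_point a (update v i y))
    (grid_point a (update v j z)) =
  (i == j)%:R * (a ^+ 2 * ((y%:R - (v i)%:R) * (z%:R - (v i)%:R))).
Proof.
rewrite /inner_at (bigD1 i) //= !tnth_mktuple !ffunE eqxx big1 ?addr0; last first.
  by move=> k /negPf ki; rewrite !tnth_mktuple !ffunE ki subrr mul0r.
rewrite /grid_coord; case: eqP => [->|_].
  by rewrite mul1r; ring.
by rewrite subrr mulr0 mul0r.
Qed.

(* [point0 y + spread y * t] puts mass [1 - t] on the middle state and [t / 2]
   on each of the two others. *)
Definition point0 (y : 'I_3) : R := ((y : nat) == 1)%:R.
Definition spread (y : 'I_3) : R := if (y : nat) == 1 then -1 else 2^-1.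

Lemma sum_point0 : \sum_y point0 y = 1.
Proof. by rewrite !big_ord_recr big_ord0 /point0 /= !add0r addr0. Qed.

Lemma sum_spread : \sum_y spread y = 0.
Proof. by rewrite !big_ord_recr big_ord0 /spread /=; field. Qed.

(** [spread] is half a second difference: it annihilates affine functions, so the terms of order 0
    and 1 in [t] cancel. *)
Lemma spread_kernel_le (t : R) (x : 'I_3) : 0 <= t -> t <= 8^-1 ->
  \sum_y \sum_z spread y * spread z *
    (expR (t * ((y%:R - x%:R) * (z%:R - x%:R))) - 1) <= t ^+ 2.
Proof.
move=> t0 t8.
have sumE (F : nat -> nat -> R) :
    \sum_(y < 3) \sum_(z < 3) spread y * spread z * (F y z - 1) =
    4^-1 * (F 0%N 0%N + F 0%N 2%N + F 2%N 0%N + F 2%N 2%N)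
    - 2^-1 * (F 0%N 1%N + F 1%N 0%N + F 1%N 2%N + F 2%N 1%N) + F 1%N 1%N.
  by rewrite !big_ord_recr !big_ord0 /spread /=; field.
pose e (r p q : nat) := expR (t * ((p%:R - r%:R) * (q%:R - r%:R))).
rewrite (sumE (e x)) /=.
(* Every kernel entry is a power of [z]: [key] treats the two outer states, [key1] the middle
   one. *)
pose z := expR t.
have z0 : 0 < z by exact: expR_gt0.
have z1 : 1 + t <= z by exact: expR_ge1Dx.
have z2 : z <= 1 + 8 / 7 * t.
  apply: le_trans (expR_le_inv _) _; first lra.
  by rewrite -div1r ler_pdivrMr; nra.
have e2 : expR (t * 2) = z ^+ 2 by rewrite mulrC expRM_natl.
have e4 : expR (t * 4) = z ^+ 4 by rewrite mulrC expRM_natl.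
have en : expR (t * -1) = z^-1 by rewrite mulrN1 expRN.
have key : 4^-1 * (1 + 1 + 1 + z ^+ 4) - 2^-1 * (1 + 1 + z ^+ 2 + z ^+ 2) + z <= t ^+ 2.
  have -> : 4^-1 * (1 + 1 + 1 + z ^+ 4) - 2^-1 * (1 + 1 + z ^+ 2 + z ^+ 2) + z =
      4^-1 * ((z - 1) ^+ 2 * (z ^+ 2 + 2 * z - 1)) by field.
  have h1 : (z - 1) ^+ 2 <= (8 / 7 * t) ^+ 2 by nra.
  have h2 : 0 <= z ^+ 2 + 2 * z - 1 <= 11 / 4 by apply/andP; split; nra.
  have h3 : (z - 1) ^+ 2 * (z ^+ 2 + 2 * z - 1) <= (8 / 7 * t) ^+ 2 * (11 / 4).
    by case/andP: h2 => ? ?; apply: ler_pM => //; exact: sqr_ge0.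
  apply: le_trans (ler_wpM2l _ h3) _; first lra.
  have := sqr_ge0 t; lra.
have key1 : 4^-1 * (z + z^-1 + z^-1 + z) - 2^-1 * (1 + 1 + 1 + 1) + 1 <= t ^+ 2.
  have -> : 4^-1 * (z + z^-1 + z^-1 + z) - 2^-1 * (1 + 1 + 1 + 1) + 1 =
      (z - 1) ^+ 2 / (2 * z) by field; rewrite gt_eqF.
  rewrite ler_pdivrMr ?mulr_gt0//.
  have h1 : (z - 1) ^+ 2 <= (8 / 7 * t) ^+ 2 by nra.
  have := sqr_ge0 t; nra.
have E0 : expR (t * 0) = 1 by rewrite mulr0 expR0.
have E1 : expR (t * 1) = z by rewrite mulr1.
have ex r p q (u : R) : (p%:R - r%:R) * (q%:R - r%:R) = u -> e r p q = expR (t * u).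
  by rewrite /e => ->.
case: x => -[|[|[|//]]] ? /=.
- rewrite (@ex 0%N 0%N 0%N (0)); last by ring.
  rewrite (@ex 0%N 0%N 2%N (0)); last by ring.
  rewrite (@ex 0%N 2%N 0%N (0)); last by ring.
  rewrite (@ex 0%N 0%N 1%N (0)); last by ring.
  rewrite (@ex 0%N 1%N 0%N (0)); last by ring.
  rewrite (@ex 0%N 2%N 2%N (4)); last by ring.
  rewrite (@ex 0%N 1%N 2%N (2)); last by ring.
  rewrite (@ex 0%N 2%N 1%N (2)); last by ring.
  rewrite (@ex 0%N 1%N 1%N (1)); last by ring.
  rewrite E0 ?E1 ?e2 ?e4 ?en; exact: key.
- rewrite (@ex 1%N 0%N 0%N (1)); last by ring.
  rewrite (@ex 1%N 2%N 2%N (1)); last by ring.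
  rewrite (@ex 1%N 0%N 2%N (-1)); last by ring.
  rewrite (@ex 1%N 2%N 0%N (-1)); last by ring.
  rewrite (@ex 1%N 0%N 1%N (0)); last by ring.
  rewrite (@ex 1%N 1%N 0%N (0)); last by ring.
  rewrite (@ex 1%N 1%N 2%N (0)); last by ring.
  rewrite (@ex 1%N 2%N 1%N (0)); last by ring.
  rewrite (@ex 1%N 1%N 1%N (0)); last by ring.
  rewrite E0 ?E1 ?e2 ?e4 ?en; exact: key1.
- rewrite (@ex 2%N 0%N 0%N (4)); last by ring.
  rewrite (@ex 2%N 0%N 2%N (0)); last by ring.
  rewrite (@ex 2%N 2%N 0%N (0)); last by ring.
  rewrite (@ex 2%N 2%N 2%N (0)); last by ring.
  rewrite (@ex 2%N 1%N 2%N (0)); last by ring.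
  rewrite (@ex 2%N 2%N 1%N (0)); last by ring.
  rewrite (@ex 2%N 0%N 1%N (2)); last by ring.
  rewrite (@ex 2%N 1%N 0%N (2)); last by ring.
  rewrite (@ex 2%N 1%N 1%N (1)); last by ring.
  rewrite E0 ?E1 ?e2 ?e4 ?en; lra.
Qed.

(** Chapman-Robbins over all pairs of a coordinate and a state. The kernel splits into [d] diagonal
    blocks, each at most [t ^+ 2], and [G * (1 - G) <= 1/4] gives the factor 1/2 after the square
    root. *)
Lemma spread_difference_le (a : R) (v : {ffun 'I_d -> 'I_3}) :
  m%:R * a ^+ 2 <= 8^-1 ->
  `|\sum_i \sum_y spread y * G (grid_point a (update v i y))| <=
  2^-1 * (Num.sqrt d%:R * (m%:R * a ^+ 2)).
Proof.
set t := _ * a ^+ 2 => t8.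
have t0 : 0 <= t by rewrite mulr_ge0// sqr_ge0.
have [_ cr] := hG.
have := cr ('I_d * 'I_3)%type (fun k => grid_point a (update v k.1 k.2))
  (fun k => spread k.2) (grid_point a v).
(* Since [spread] sums to 0, the value at the base point drops out. *)
rewrite -(pair_bigA _ (fun i y => spread y *
  (G (grid_point a (update v i y)) - G (grid_point a v)))) /=.
under eq_bigr => i _.
  under eq_bigr => y _ do rewrite mulrBr.
  rewrite sumrB -mulr_suml sum_spread mul0r subr0.
  over.
set D := \sum_i _ => /= hD.
have kernel : \sum_(k : 'I_d * 'I_3) \sum_(l : 'I_d * 'I_3)
    spread k.2 * spread l.2 * (expR (m%:R * inner_at (grid_point a v)
      (grid_point a (update v k.1 k.2)) (grid_point a (update v l.1 l.2))) - 1) <=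
    d%:R * t ^+ 2.
  rewrite -(pair_bigA _ (fun i y => \sum_(l : 'I_d * 'I_3)
    spread y * spread l.2 * (expR (m%:R * inner_at (grid_point a v)
      (grid_point a (update v i y)) (grid_point a (update v l.1 l.2))) - 1))) /=.
  rewrite (_ : d%:R * t ^+ 2 = \sum_(i < d) t ^+ 2); last first.
    by rewrite sumr_const card_ord mulr_natl.
  apply: ler_sum => i _; apply: le_trans (spread_kernel_le (v i) t0 t8).
  rewrite le_eqVlt; apply/orP; left; apply/eqP; apply: eq_bigr => y _.
  rewrite -(pair_bigA _ (fun j z => spread y * spread z *
    (expR (m%:R * inner_at (grid_point a v)
      (grid_point a (update v i y)) (grid_point a (update v j z))) - 1))) /=.
  rewrite (bigD1 i) //= [X in _ + X]big1 ?addr0.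
    by apply: eq_bigr => z _; rewrite inner_grid_point eqxx mul1r mulrA.
  move=> j /negPf ji; rewrite big1// => z _.
  by rewrite inner_grid_point eq_sym ji mul0r mulr0 expR0 subrr mulr0.
have /andP[v0 v1] := var_le_quarter (grid_point a v).
have rhs0 : 0 <= 2^-1 * (Num.sqrt d%:R * t).
  by rewrite mulr_ge0 ?invr_ge0// mulr_ge0// sqrtr_ge0.
rewrite -(ler_pXn2r (n := 2)) ?nnegrE//.
rewrite real_normK ?num_real// (le_trans hD)// (le_trans (ler_wpM2l v0 kernel))//.
have -> : (2^-1 * (Num.sqrt d%:R * t)) ^+ 2 = 4^-1 * (d%:R * t ^+ 2).
  by rewrite -[in RHS](sqr_sqrtr (ler0n R d)); field.
by apply: ler_wpM2r => //; rewrite mulr_ge0// sqr_ge0.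
Qed.

(** Chapman-Robbins with the differences themselves as coefficients: their sum of squares [X]
    satisfies [X ^+ 2 <= G * (1 - G) * K] with [K <= X]. *)
Lemma sum_sqr_difference_le (a : R) (v w : {ffun 'I_d -> 'I_3}) :
  m%:R * a ^+ 2 <= 8^-1 ->
  \sum_i (G (grid_point a v) - G (grid_point a (update v i (w i)))) ^+ 2 <=
  G (grid_point a v) * (1 - G (grid_point a v)).
Proof.
set t := _ * a ^+ 2 => t8.
have t0 : 0 <= t by rewrite mulr_ge0// sqr_ge0.
have [_ cr] := hG.
pose D i := G (grid_point a (update v i (w i))) - G (grid_point a v).
have := cr 'I_d (fun i => grid_point a (update v i (w i))) D (grid_point a v).
have -> : \sum_i (G (grid_point a v) - G (grid_point a (update v i (w i)))) ^+ 2 =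
    \sum_i D i * D i.
  by apply: eq_bigr => i _; rewrite /D -expr2 -sqrrN opprB.
set X := \sum_i D i * _.
have X0 : 0 <= X by apply: sumr_ge0 => i _; rewrite -expr2 sqr_ge0.
set K := \sum_i \sum_j _ => hcr.
have KX : K <= X.
  apply: ler_sum => i _; rewrite (bigD1 i) //= big1 ?addr0; last first.
    move=> j /negPf ji.
    by rewrite inner_grid_point eq_sym ji mul0r mulr0 expR0 subrr mulr0.
  rewrite -/(D i) inner_grid_point eqxx mul1r mulrA -expr2 -/t.
  rewrite ler_piMr -?expr2 ?sqr_ge0// lerBlDr.
  (* A coordinate moves by at most two states, so the exponent is at most 4/8, and [expR] there is
     at most 2. *)
  have wv : t * (((w i)%:R - (v i)%:R) ^+ 2) <= 2^-1.
    have : ((w i)%:R - (v i)%:R) ^+ 2 <= 4 :> R.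
      by case: (w i) => -[|[|[|//]]] ?; case: (v i) => -[|[|[|//]]] ? /=; lra.
    nra.
  apply: le_trans (expR_le_inv _) _; first lra.
  by rewrite -div1r ler_pdivrMr; lra.
have /andP[v0 v1] := var_le_quarter (grid_point a v).
have [->|Xn0] := eqVneq X 0; first by [].
have Xp : 0 < X by rewrite lt_def Xn0.
by rewrite -(ler_pM2r Xp) -expr2 (le_trans hcr)// ler_wpM2l.
Qed.

(** With [V] the mean of [G * (1 - G)], [P * (1 - P)] is [V] plus the variance of [G], and
    Efron-Stein bounds that variance by [V / 2]. *)
Lemma grid_variance_le (a : R) (q : 'I_3 -> R) :
  (forall y, 0 <= q y) -> \sum_y q y = 1 -> m%:R * a ^+ 2 <= 8^-1 ->
  (\sum_v weight q v * G (grid_point a v)) *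
    (1 - \sum_v weight q v * G (grid_point a v)) <=
  3 / 2 * \sum_v weight q v * (G (grid_point a v) * (1 - G (grid_point a v))).
Proof.
move=> q0 q1 t8; set P := \sum_v weight q v * G (grid_point a v).
pose g v := G (grid_point a v).
set V := \sum_v _.
have := efron_stein g q0 q1.
rewrite -/P exchange_big /=.
have : \sum_(p : {ffun 'I_d -> 'I_3} * {ffun 'I_d -> 'I_3}) \sum_(i < d)
    weight q p.1 * weight q p.2 * (g p.1 - g (update p.1 i (p.2 i))) ^+ 2 <= V.
  have -> : V = \sum_(p : {ffun 'I_d -> 'I_3} * {ffun 'I_d -> 'I_3})
      weight q p.1 * weight q p.2 * (g p.1 * (1 - g p.1)).
    rewrite -(pair_bigA _ (fun v w => weight q v * weight q w * (g v * (1 - g v)))) /=.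
    apply: eq_bigr => v _; rewrite -mulr_suml -mulr_sumr sum_weight// mulr1//.
  apply: ler_sum => p _; rewrite -mulr_sumr ler_wpM2l ?mulr_ge0 ?weight_ge0//.
  exact: sum_sqr_difference_le.
have : V = P - \sum_v weight q v * g v ^+ 2.
  by rewrite -sumrB; apply: eq_bigr => v _; rewrite -/(g v); ring.
clearbody P V; move: (\sum_v weight q v * g v ^+ 2) => S2.
move: (\sum_p _) => X VE XV es; lra.
Qed.

Definition mix (t : R) (y : 'I_3) : R := point0 y + spread y * t.

Lemma mix_ge0 t y : 0 <= t <= 1 -> 0 <= mix t y.
Proof.
by move=> /andP[? ?]; rewrite /mix /point0 /spread; case: eqP => _ /=; lra.
Qed.

Lemma sum_mix t : \sum_y mix t y = 1.
Proof. by rewrite big_split /= -mulr_suml sum_point0 sum_spread mul0r addr0. Qed.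

Definition grid_mean (a t : R) : R :=
  \sum_v weight (mix t) v * G (grid_point a v).

Lemma grid_mean_itv a t : 0 <= t <= 1 -> 0 <= grid_mean a t <= 1.
Proof.
move=> t01; apply/andP; split.
  apply: sumr_ge0 => v _; rewrite mulr_ge0 ?weight_ge0// => [y|].
    exact: mix_ge0.
  by have /andP[] := G01 (grid_point a v).
rewrite -(@sum_weight R d _ _ (sum_mix t)); apply: ler_sum => v _.
rewrite ler_piMr ?weight_ge0// => [y|]; first exact: mix_ge0.
by have /andP[] := G01 (grid_point a v).
Qed.

Lemma grid_mean0 a : grid_mean a 0 = G (grid_point a [ffun=> inord 1]).
Proof.
rewrite /grid_mean (bigD1 [ffun=> inord 1]) //= big1 ?addr0.
  rewrite /weight big1 ?mul1r// => i _.
  by rewrite /mix /point0 ffunE inordK// mulr0 addr0.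
move=> v; apply: contraNeq => wv; apply/eqP/ffunP => i; rewrite ffunE.
apply/val_inj; rewrite /= inordK//.
move: wv; rewrite mulf_eq0 negb_or => /andP[+ _].
rewrite /weight (bigD1 i) //= mulf_eq0 negb_or => /andP[+ _].
by rewrite /mix /point0 mulr0 addr0 pnatr_eq0 eqb0 negbK => /eqP.
Qed.

Lemma grid_mean_lipschitz (a s t : R) : m%:R * a ^+ 2 <= 8^-1 ->
  0 <= s -> s <= t -> t <= 1 ->
  grid_mean a s - grid_mean a t <=
  2^-1 * (Num.sqrt d%:R * (m%:R * a ^+ 2)) * (t - s).
Proof.
move=> t8 s0 st t1; apply: le_trans (ler_norm _) _; rewrite distrC.
apply: mean_lipschitz => //; [exact: sum_point0|exact: sum_spread| |].
  by move=> x y; exact: mix_ge0.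
by move=> v; exact: spread_difference_le.
Qed.

(** The condition on [N] makes the mean move by at most 1/5 per step; [grid_variance_le] then
    replaces each [p * (1 - p)] of the means by a mean of [G * (1 - G)]. *)
Lemma grid_path (a : R) (N : nat) : (0 < N)%N -> m%:R * a ^+ 2 <= 8^-1 ->
  5 * (2^-1 * (Num.sqrt d%:R * (m%:R * a ^+ 2))) <= N%:R ->
  3 / 5 * (grid_mean a 0 - grid_mean a 1 - 3 / 5) <=
  \sum_(k < N.+1) 3 / 2 * \sum_v weight (mix (k%:R / N%:R)) v *
    (G (grid_point a v) * (1 - G (grid_point a v))).
Proof.
move=> N0 t8 hN; have N0' : 0 < N%:R :> R by rewrite ltr0n.
(* clamping keeps the parameter in the unit interval for every index *)
pose s (k : nat) : R := Num.min 1 (k%:R / N%:R).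
have s01 k : 0 <= s k <= 1 by rewrite /s ge_min lexx/= le_min ler01 divr_ge0.
have sE k : (k <= N)%N -> s k = k%:R / N%:R.
  by move=> kN; rewrite /s min_r// ler_pdivrMr// mul1r ler_nat.
rewrite (_ : grid_mean a 0 = grid_mean a (s 0)); last by rewrite sE// mul0r.
rewrite (_ : grid_mean a 1 = grid_mean a (s N)); last first.
  by rewrite sE// divff// gt_eqF.
apply: le_trans (@sum_crossing_ge R (fun k => grid_mean a (s k)) N _ _) _.
- by move=> k; exact: grid_mean_itv.
- move=> k kN.
  have step : s k.+1 - s k = N%:R^-1.
    by rewrite !sE ?(ltnW kN)// -natr1 -mulrBl addrAC subrr add0r mul1r.
  have /andP[s0 _] := s01 k; have /andP[_ s1] := s01 k.+1.
  apply: le_trans (grid_mean_lipschitz t8 s0 _ s1) _.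
    by rewrite -subr_ge0 step invr_ge0 ltW.
  by rewrite step ler_pdivrMr//; lra.
- apply: ler_sum => k _; rewrite -(sE k); last by rewrite -ltnS.
  by apply: grid_variance_le => //; [move=> y; exact: mix_ge0|exact: sum_mix].
Qed.

End cr_bounded.

(** * Averaging over the internal randomness *)

Section randomized_test.
Context (R : realType) d (T : measurableType d) dOm (Om : measurableType dOm).
Context (P : probability T R) (Q : probability Om R).
Variable A : {mfun (T * Om)%type >-> bool}.

Definition accept_region (r : Om) : set T := [set x | A (x, r) = true].

Lemma measurable_accept_region r : measurable (accept_region r).
Proof.
have mA : measurable_fun setT (fun x => A (x, r)).
  exact: measurableT_comp (measurable_funPT A) (measurable_pair2 r).
by have := mA measurableT [set true] I; rewrite setTI.
Qed.

Lemma measurable_output (b : bool) : measurable [set z | A z = b].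
Proof. by have := measurable_funPT A measurableT [set b] I; rewrite setTI. Qed.

(** Uniqueness of the product measure puts the integral over [r] outermost, so that [r] can be fixed
    first. *)
Lemma product_measure_ysectionE d' (T' : measurableType d')
    (P' : probability T' R) (B : set (T' * Om)) : measurable B ->
  ((P' \x Q) B = \int[Q]_r P' (ysection B r))%E.
Proof.
move=> mB; rewrite (product_measure_unique _ _ (m' := (P' \x^ Q)%E))//.
by move=> C D mC mD; rewrite /= product_measure2E.
Qed.

Definition accept_prob (r : Om) : R := fine (P (accept_region r)).

Lemma accept_prob_itv r : 0 <= accept_prob r <= 1.
Proof.
rewrite /accept_prob fine_ge0//= -lee_fin fineK ?probability_le1//.
  exact: measurable_accept_region.
by rewrite fin_num_measure//; exact: measurable_accept_region.
Qed.

Lemma accept_probE r : P (accept_region r) = (accept_prob r)%:E.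
Proof. by rewrite fineK// fin_num_measure//; exact: measurable_accept_region. Qed.

Lemma measurable_accept_prob : measurable_fun setT accept_prob.
Proof.
apply/measurable_EFinP.
rewrite (_ : _ \o _ = P \o ysection [set z | A z = true]).
  exact: measurable_fun_ysection (measurable_output true).
apply/funext => r; rewrite /= -accept_probE; congr (P _).
by apply/seteqP; split => x /=; rewrite /ysection /= inE.
Qed.

Lemma prob_accept :
  ((P \x Q) [set z | A z = true] = \int[Q]_r (accept_prob r)%:E)%E.
Proof.
rewrite product_measure_ysectionE; last exact: measurable_output.
apply: eq_integral => r _; rewrite -accept_probE; congr (P _).
by apply/seteqP; split => x /=; rewrite /ysection /= inE.
Qed.

Lemma prob_reject :
  ((P \x Q) [set z | A z = false] = \int[Q]_r (1 - accept_prob r)%:E)%E.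
Proof.
rewrite product_measure_ysectionE; last exact: measurable_output.
apply: eq_integral => r _.
rewrite (_ : ysection _ r = ~` accept_region r).
  by rewrite probability_setC ?accept_probE//; exact: measurable_accept_region.
apply/seteqP; split => x /=; rewrite /ysection /accept_region /= inE.
  by move=> /= ->.
by move=> /=; case: (A _).
Qed.

(** For fixed [r] the two runs are independent, and they agree on the disjoint union of the squares
    of the acceptance region and of its complement. *)
Lemma prob_agree :
  (((P \x P) \x Q) [set z | A (z.1.1, z.2) = A (z.1.2, z.2)] =
   \int[Q]_r (accept_prob r ^+ 2 + (1 - accept_prob r) ^+ 2)%:E)%E.
Proof.
have m1 : measurable_fun setT (fun z : T * T * Om => A (z.1.1, z.2)).
  apply: measurableT_comp => //; apply/measurable_fun_pair => //.
  exact: measurableT_comp.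
have m2 : measurable_fun setT (fun z : T * T * Om => A (z.1.2, z.2)).
  apply: measurableT_comp => //; apply/measurable_fun_pair => //.
  exact: measurableT_comp.
have mB : measurable [set z : T * T * Om | A (z.1.1, z.2) = A (z.1.2, z.2)].
  rewrite (_ : [set z | _] =
    ((fun z : T * T * Om => A (z.1.1, z.2)) @^-1` [set true] `&`
     (fun z : T * T * Om => A (z.1.2, z.2)) @^-1` [set true]) `|`
    ((fun z : T * T * Om => A (z.1.1, z.2)) @^-1` [set false] `&`
     (fun z : T * T * Om => A (z.1.2, z.2)) @^-1` [set false])).
    apply: measurableU; apply: measurableI.
    - by have := m1 measurableT [set true] I; rewrite setTI.
    - by have := m2 measurableT [set true] I; rewrite setTI.
    - by have := m1 measurableT [set false] I; rewrite setTI.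
    - by have := m2 measurableT [set false] I; rewrite setTI.
  apply/seteqP; split => z /=; last by case=> -[-> ->].
  by case: (A (z.1.2, z.2)) => ->; [left|right].
rewrite product_measure_ysectionE//.
apply: eq_integral => r _.
have mS := measurable_accept_region r.
rewrite (_ : ysection _ r = accept_region r `*` accept_region r `|`
    ~` accept_region r `*` ~` accept_region r); last first.
  apply/seteqP; split => -[x y];
    rewrite /ysection /accept_region /= ?inE /=.
    by case: (A (y, r)) => ->; [left|right].
  by case=> -[]; case: (A (x, r)); case: (A (y, r)).
rewrite measureU.
- rewrite EFinD; congr (_ + _)%E.
    apply: etrans (product_measure1E _ _ mS mS) _; rewrite expr2 EFinM.
    by congr (_ * _)%E; exact: accept_probE.
  have mSc := measurableC mS.
  have PSc : P (~` accept_region r) = (1 - accept_prob r)%:E.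
    by rewrite probability_setC// accept_probE.
  apply: etrans (product_measure1E _ _ mSc mSc) _; rewrite expr2 EFinM.
  by congr (_ * _)%E; exact: PSc.
- exact: measurableX.
- by apply: measurableX; exact: measurableC.
- by apply/seteqP; split => // -[x y] /= [[? ?] [? ?]].
Qed.

End randomized_test.

(** * Integrating the path inequalities over the randomness *)

Section bounded_expectation.
Context (R : realType) dOm (Om : measurableType dOm) (Q : probability Om R).

Lemma integrable_unit (f : Om -> R) : measurable_fun setT f ->
  (forall r, 0 <= f r <= 1) -> Q.-integrable setT (EFin \o f).
Proof.
move=> mf f01; apply: measurable_bounded_integrable => //.
  exact: le_lt_trans (probability_le1 Q measurableT) (ltry 1).
exists 1; split => // x x1 r _ /=; have /andP[f0 f1] := f01 r.
by rewrite ger0_norm// (le_trans f1)// ltW.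
Qed.

Lemma Rintegral_probability_cst (c : R) : \int[Q]_r c = c.
Proof.
rewrite Rintegral_cst// (_ : fine _ = 1) ?mulr1//.
exact: (congr1 fine (probability_setT Q)).
Qed.

Lemma Rintegral_lincomb (I : finType) (w : I -> R) (f : I -> Om -> R) :
  (forall i, measurable_fun setT (f i)) -> (forall i r, 0 <= f i r <= 1) ->
  Q.-integrable setT (EFin \o (fun r => \sum_i w i * f i r)) /\
  \int[Q]_r (\sum_i w i * f i r) = \sum_i w i * \int[Q]_r f i r.
Proof.
move=> mf f01.
have fi i : Q.-integrable setT (EFin \o f i) by exact: integrable_unit.
have wfi i : Q.-integrable setT (EFin \o (fun r => w i * f i r)).
  rewrite (_ : _ \o _ = (fun r => (w i)%:E * (EFin \o f i) r)%E)//.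
  by apply: integrableZl => //; exact: fi.
have [h1 h2] := integrable_Rintegral_sum (index_enum I) wfi.
by split=> //; rewrite h2; apply: eq_bigr => i _; rewrite RintegralZl//.
Qed.

(** The constant is 3/5 * (99/100 - 1/100 - 3/5). The weights [u] form a prior on alternatives, with
    rejection required only on its support, and [w] weighs the points visited by the path; this
    covers both the segment and the grid. *)
Lemma integrate_crossing (V : Type) (g : V -> Om -> R) (rho : R)
    (nu0 : V) (I J : finType) (u : I -> R) (nu : I -> V) (w : J -> R)
    (mu : J -> V) :
  (forall v, measurable_fun setT (g v)) -> (forall v r, 0 <= g v r <= 1) ->
  (forall j, \int[Q]_r (g (mu j) r * (1 - g (mu j) r)) <= rho / 2) ->
  99 / 100 <= \int[Q]_r g nu0 r ->
  (forall i, 0 <= u i) -> \sum_i u i = 1 ->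
  (forall i, u i != 0 -> \int[Q]_r g (nu i) r <= 100^-1) ->
  (forall j, 0 <= w j) ->
  (forall r, 3 / 5 * (g nu0 r - \sum_i u i * g (nu i) r - 3 / 5) <=
    \sum_j w j * (g (mu j) r * (1 - g (mu j) r))) ->
  57 / 250 <= (\sum_j w j) * (rho / 2).
Proof.
move=> mg g01 hrho h0 u0 u1 hu w0 hpt.
have mgg v : measurable_fun setT (fun r => g v r * (1 - g v r)).
  by apply: measurable_funM => //; exact: measurable_funB.
have gg01 v r : 0 <= g v r * (1 - g v r) <= 1.
  have /andP[a b] := g01 v r; rewrite mulr_ge0 ?subr_ge0//=.
  by rewrite mulr_ile1 ?subr_ge0// gerBl.
have [iJ eJ] := Rintegral_lincomb w (fun j => mgg (mu j)) (fun j => gg01 (mu j)).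
have [iI eI] := Rintegral_lincomb u (fun i => mg (nu i)) (fun i => g01 (nu i)).
have i0 := integrable_unit (mg nu0) (g01 nu0).
have icst (c : R) : Q.-integrable setT (EFin \o (fun=> c)).
  exact: finite_measure_integrable_cst.
pose f1 r := g nu0 r - \sum_i u i * g (nu i) r.
have if1 : Q.-integrable setT (EFin \o f1).
  rewrite (_ : _ \o _ = ((EFin \o g nu0) \-
      (EFin \o (fun r => (\sum_i u i * g (nu i) r)%R)))%E)//.
  exact: integrableB.
pose f2 r := f1 r - 3 / 5.
have if2 : Q.-integrable setT (EFin \o f2).
  rewrite (_ : _ \o _ = ((EFin \o f1) \- (EFin \o (fun=> (3 / 5)%R)))%E)//.
  by apply: integrableB => //; exact: icst.
have if3 : Q.-integrable setT (EFin \o (fun r => 3 / 5 * f2 r)).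
  rewrite (_ : _ \o _ = (fun r => (3 / 5)%:E * (EFin \o f2) r)%E)//.
  by apply: integrableZl => //; exact: if2.
have e1 : \int[Q]_r f1 r = \int[Q]_r g nu0 r - \sum_i u i * \int[Q]_r g (nu i) r.
  by rewrite -eI; exact: RintegralB.
have e2 : \int[Q]_r f2 r = \int[Q]_r f1 r - 3 / 5.
  rewrite -[in RHS](Rintegral_probability_cst (3 / 5)).
  by apply: RintegralB => //; exact: icst.
have := le_Rintegral measurableT if3 iJ (fun r _ => hpt r).
rewrite RintegralZl// e2 e1 eJ.
have hI : \sum_i u i * \int[Q]_r g (nu i) r <= 100^-1.
  have -> : 100^-1 = \sum_i u i * 100^-1 by rewrite -mulr_suml u1 mul1r.
  apply: ler_sum => i _.
  have [->|ui] := eqVneq (u i) 0; first by rewrite !mul0r.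
  by apply: ler_wpM2l => //; exact: hu.
have hJ : \sum_j w j * \int[Q]_r (g (mu j) r * (1 - g (mu j) r)) <=
    (\sum_j w j) * (rho / 2).
  by rewrite mulr_suml; apply: ler_sum => j _; apply: ler_wpM2l.
move=> h; have := le_trans h hJ.
move: h0 hI; move: (\int[Q]_r g nu0 r) (\sum_i _) (_ * (rho / 2)).
by move=> a b e; lra.
Qed.

End bounded_expectation.

(** * The sample complexity bound *)

Section replicable_tester.
Context (R : realType) (d m : nat) dOm (Om : measurableType dOm).
Context (Q : probability Om R) (g : vec R d -> Om -> R) (alpha rho : R).
Hypothesis mg : forall nu, measurable_fun setT (g nu).
Hypothesis hcr : forall r, cr_bounded m (g ^~ r).
Hypothesis hrho : forall nu, \int[Q]_r (g nu r * (1 - g nu r)) <= rho / 2.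
Hypothesis hacc : 99 / 100 <= \int[Q]_r g (origin R d) r.
Hypothesis hrej : forall nu, alpha <= l2norm nu -> \int[Q]_r g nu r <= 100^-1.
Hypothesis d0 : (0 < d)%N.
Hypothesis alpha0 : 0 < alpha.
Hypothesis rho0 : 0 < rho.

Let g01 nu r : 0 <= g nu r <= 1. Proof. by case: (hcr r). Qed.

Lemma axis_point0 (i0 : 'I_d) : axis_point i0 0 = origin R d.
Proof.
by apply: eq_from_tnth => i; rewrite tnth_mktuple tnth_nseq if_same.
Qed.

Lemma l2norm_axis_point (i0 : 'I_d) : l2norm (axis_point i0 alpha) = alpha.
Proof.
rewrite /l2norm (bigD1 i0) //= tnth_mktuple eqxx big1 ?addr0.
  by rewrite sqrtr_sqr gtr0_norm.
by move=> i /negPf ii0; rewrite tnth_mktuple ii0 expr0n.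
Qed.

(** Otherwise one step leads from the origin to an alternative, so the crossing inequality holds
    with an empty right side and gives [57 / 250 <= 0]. *)
Lemma sample_size_ge : 16^-1 < m%:R * alpha ^+ 2.
Proof.
rewrite ltNge; apply/negP => h.
pose i0 := Ordinal d0.
have := @integrate_crossing R _ _ Q _ g rho (origin R d) unit 'I_0 (fun=> 1)
  (fun=> axis_point i0 alpha) (fun=> 0) (fun=> origin R d) mg g01
  (fun=> hrho _) hacc (fun=> ler01).
rewrite big_const card_unit /= addr0 => /(_ erefl).
have hr (u : unit) : 1 != 0 :> R -> \int[Q]_r g (axis_point i0 alpha) r <= 100^-1.
  by move=> _; apply: hrej; rewrite l2norm_axis_point.
move=> /(_ hr (fun=> lexx 0)).
rewrite big_ord0 mul0r => hh.
suff : 57 / 250 <= 0 :> R by move=> {hh hr} h0; lra.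
apply: hh => {hr} r; rewrite big_ord0 big_const card_unit /= addr0 mul1r.
have := @cr_bounded_step R d m _ (hcr r) (axis_point i0 0) (axis_point i0 alpha).
rewrite inner_axis_point subr0 axis_point0 => /(_ h); lra.
Qed.

Lemma sample_size_ge_sqr_rho : 1 <= 700 * (m%:R * alpha ^+ 2 * rho ^+ 2).
Proof.
pose i0 := Ordinal d0.
(* The number of steps that [axis_path] asks for, before rounding up to [N]. *)
pose X : R := Num.sqrt (16 * (m%:R * alpha ^+ 2)).
have ma := sample_size_ge.
have X2 : X ^+ 2 = 16 * (m%:R * alpha ^+ 2) by rewrite sqr_sqrtr//; lra.
have X1 : 1 <= X.
  rewrite -(ler_pXn2r (n := 2)) ?nnegrE ?sqrtr_ge0// expr1n X2; lra.
have /andP[N1 N2] := truncn_itv (le_trans ler01 X1).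
set N := (Num.truncn X).+1 in N2.
(* [N + 1 <= X + 2], and [X >= 1] absorbs the rounding. *)
have NX : N.+1%:R <= 3 * X by rewrite -natr1 /N -natr1; lra.
have hN : 16 * (m%:R * alpha ^+ 2) <= N%:R ^+ 2.
  by rewrite -X2 ler_pXn2r ?nnegrE ?sqrtr_ge0// ltW.
have := @integrate_crossing R _ _ Q _ g rho (origin R d) unit 'I_N.+1 (fun=> 1)
  (fun=> axis_point i0 alpha) (fun=> 1)
  (fun k => axis_point i0 (k%:R * (alpha / N%:R))) mg g01
  (fun=> hrho _) hacc (fun=> ler01).
rewrite big_const card_unit /= addr0 => /(_ erefl).
have hr (u : unit) : 1 != 0 :> R -> \int[Q]_r g (axis_point i0 alpha) r <= 100^-1.
  by move=> _; apply: hrej; rewrite l2norm_axis_point.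
move=> /(_ hr (fun=> ler01)).
rewrite sumr_const card_ord => hh.
have {}hh : 57 / 250 <= N.+1%:R * (rho / 2).
  apply: hh => {hr} r; rewrite big_const card_unit /= addr0 mul1r.
  have := @axis_path R d m _ (hcr r) i0 alpha N (ltn0Sn _) hN.
  rewrite axis_point0 => /le_trans; apply.
  by apply: ler_sum => k _; rewrite mul1r.
clear hr.
have Xr : 57 / 375 <= X * rho by nra.
have : 23 / 1000 <= (X * rho) ^+ 2 by move: (X * rho) Xr => u Xr; nra.
have -> : (X * rho) ^+ 2 = 16 * (m%:R * alpha ^+ 2 * rho ^+ 2).
  by rewrite exprMn X2; ring.
by move: (m%:R * alpha ^+ 2 * rho ^+ 2) => q; lra.
Qed.

Lemma grid_point_center (a : R) : grid_point a [ffun=> inord 1] = origin R d.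
Proof.
apply: eq_from_tnth => i; rewrite tnth_mktuple tnth_nseq ffunE /grid_coord.
by rewrite inordK// subrr mulr0.
Qed.

(** At parameter 1 the middle state has weight 0, so on the support every coordinate is plus or
    minus [alpha / sqrt d]. *)
Lemma l2norm_grid_point (v : {ffun 'I_d -> 'I_3}) :
  weight (mix 1) v != 0 :> R ->
  l2norm (grid_point (alpha / Num.sqrt d%:R) v) = alpha.
Proof.
move=> wv; rewrite /l2norm.
have sd : 0 < Num.sqrt d%:R :> R by rewrite sqrtr_gt0 ltr0n.
rewrite (eq_bigr (fun=> alpha ^+ 2 / d%:R)); last first.
  move=> i _; rewrite tnth_mktuple exprMn expr_div_n sqr_sqrtr//.
  have -> : grid_coord R (v i) ^+ 2 = 1; last by rewrite mulr1.
  move: wv; rewrite /weight (bigD1 i) //= mulf_eq0 negb_or => /andP[+ _].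
  rewrite /mix /point0 /spread /grid_coord mulr1.
  by case: (v i) => -[|[|[|//]]] ? /=; rewrite ?subrr ?addrN ?eqxx// => _; ring.
rewrite sumr_const card_ord -(mulr_natr (alpha ^+ 2 / d%:R) d) divfK ?pnatr_eq0 -?lt0n//.
by rewrite sqrtr_sqr gtr0_norm.
Qed.

Lemma sample_size_ge_sqrt_dim :
  m%:R * alpha ^+ 2 <= d%:R / 8 ->
  Num.sqrt d%:R <= 25 * (m%:R * alpha ^+ 2 * rho).
Proof.
move=> mad.
have sd : 0 < Num.sqrt d%:R :> R by rewrite sqrtr_gt0 ltr0n.
have sd2 : Num.sqrt d%:R ^+ 2 = d%:R :> R by rewrite sqr_sqrtr.
have d0' : 0 < d%:R :> R by rewrite ltr0n.
pose a := alpha / Num.sqrt d%:R.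
have tE : m%:R * a ^+ 2 = m%:R * alpha ^+ 2 / d%:R.
  by rewrite /a expr_div_n sd2 mulrA.
have t8 : m%:R * a ^+ 2 <= 8^-1 by rewrite tE ler_pdivrMr// [leRHS]mulrC.
pose L := 2^-1 * (Num.sqrt d%:R * (m%:R * a ^+ 2)).
have L0 : 0 <= L.
  by rewrite mulr_ge0 ?invr_ge0// mulr_ge0 ?sqrtr_ge0// mulr_ge0 ?sqr_ge0.
have hr v : weight (mix 1) v != 0 :> R -> \int[Q]_r g (grid_point a v) r <= 100^-1.
  by move=> wv; apply: hrej; rewrite l2norm_grid_point.
have w1 : 0 <= (1 : R) <= 1 by rewrite ler01 lexx.
(* [L] bounds the total movement of the mean; if it were at most 1/5, the crossing inequality would
   hold with an empty right side. *)
have L5 : 5^-1 < L.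
  rewrite ltNge; apply/negP => L5.
  have hh := @integrate_crossing R _ _ Q _ g rho (origin R d)
    {ffun 'I_d -> 'I_3} 'I_0 (weight (mix 1)) (grid_point a) (fun=> 0)
    (fun=> origin R d) mg g01 (fun=> hrho _) hacc
    (fun v => weight_ge0 v (fun y => mix_ge0 y w1))
    (@sum_weight R d _ _ (sum_mix 1)) hr (fun=> lexx 0).
  suff : 57 / 250 <= (\sum_(j < 0) 0) * (rho / 2) :> R.
    by rewrite big_ord0 mul0r => {hh hr} h0; lra.
  apply: hh => {hr} r; rewrite big_ord0.
  have := @grid_mean_lipschitz R d m _ (hcr r) a 0 1 t8 (lexx 0) ler01 (lexx 1).
  rewrite grid_mean0 grid_point_center -/L /grid_mean; lra.
have /andP[N1 N2] := truncn_itv (mulr_ge0 (ler0n R 5) L0).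
set N := (Num.truncn (5 * L)).+1 in N2.
(* [N + 1 <= 5 * L + 2], and [L > 1/5] absorbs the rounding. *)
have NL : N.+1%:R <= 15 * L by rewrite -natr1 /N -natr1; lra.
pose w (p : 'I_N.+1 * {ffun 'I_d -> 'I_3}) : R :=
  3 / 2 * weight (mix (p.1%:R / N%:R)) p.2.
have kN (k : 'I_N.+1) : 0 <= (k%:R / N%:R : R) <= 1.
  by rewrite divr_ge0//= ler_pdivrMr ?ltr0n// mul1r ler_nat -ltnS.
have hh : 57 / 250 <= (\sum_p w p) * (rho / 2).
  apply: (@integrate_crossing R _ _ Q _ g rho (origin R d)
    {ffun 'I_d -> 'I_3} _ (weight (mix 1)) (grid_point a) w
    (fun p => grid_point a p.2) mg g01 (fun=> hrho _) hacc) => //.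
  - by move=> v; apply: weight_ge0 => y; exact: mix_ge0.
  - by apply: sum_weight; exact: sum_mix.
  - move=> p; rewrite mulr_ge0//.
    by apply: weight_ge0 => y; apply: mix_ge0.
  - move=> r.
    have := @grid_path R d m _ (hcr r) a N (ltn0Sn _) t8 (ltW N2).
    rewrite grid_mean0 grid_point_center /grid_mean => /le_trans; apply.
    rewrite -(pair_bigA _ (fun k v => w (k, v) *
      (g (grid_point a v) r * (1 - g (grid_point a v) r)))) /=.
    apply: ler_sum => k _; rewrite mulr_sumr; apply: ler_sum => v _.
    by rewrite /w /= [leLHS]mulrA.
have sw : \sum_p w p = N.+1%:R * (3 / 2).
  rewrite -(pair_bigA _ (fun k v => w (k, v))) /=.
  rewrite (eq_bigr (fun=> 3 / 2)); last first.
    move=> k _; rewrite /w /= -mulr_sumr sum_weight ?mulr1//.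
    exact: sum_mix.
  by rewrite sumr_const card_ord [RHS]mulr_natl.
clear hr.
(* The total weight is at most [15 * L * (3 / 2)], so [57 / 250 <= 45 / 4 * (L * rho)]. *)
have Lr : 57 / 250 * 4 / 45 <= L * rho by move: hh; rewrite sw; nra.
have LE : L * Num.sqrt d%:R = 2^-1 * (m%:R * alpha ^+ 2).
  rewrite /L tE; move: sd sd2; move: (Num.sqrt d%:R) => s s0 <-.
  by field; rewrite gt_eqF.
have : 57 / 250 * 4 / 45 * Num.sqrt d%:R <= L * Num.sqrt d%:R * rho.
  by rewrite [leRHS]mulrAC ler_pM2r.
rewrite LE -[leRHS]mulrA; move: sd; move: (Num.sqrt _) => s s0.
by move: (m%:R * alpha ^+ 2 * rho) => q hs; lra.
Qed.

Lemma sample_complexity :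
  1000^-1 * (Num.sqrt d%:R / (alpha ^+ 2 * rho) +
             1 / (alpha ^+ 2 * rho ^+ 2)) <= m%:R.
Proof.
have a2 : 0 < alpha ^+ 2 by rewrite exprn_gt0.
have r2 : 0 < rho ^+ 2 by rewrite exprn_gt0.
have h1 : 1 / (alpha ^+ 2 * rho ^+ 2) <= 700 * m%:R.
  rewrite ler_pdivrMr ?mulr_gt0//.
  by have := sample_size_ge_sqr_rho; rewrite !mulrA.
have h2 : Num.sqrt d%:R / (alpha ^+ 2 * rho) <= 75 * m%:R; last first.
  move: h1 h2 (ler0n R m); move: (1 / _) (Num.sqrt _ / _) => x y; lra.
rewrite ler_pdivrMr ?mulr_gt0// -mulrA [X in 75 * X]mulrA.
have q0 : 0 <= m%:R * alpha ^+ 2 :> R by rewrite mulr_ge0// ltW.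
have [hd|hd] := leP (m%:R * alpha ^+ 2) (d%:R / 8).
  have := sample_size_ge_sqrt_dim hd.
  have : 0 <= m%:R * alpha ^+ 2 * rho by rewrite mulr_ge0// ltW.
  by move: (_ * rho) => q; lra.
(* for [m * alpha^2] beyond [d / 8], the geometric mean of this bound and of
   the bound in [rho^2] *)
have qr : 0 <= 75 * (m%:R * alpha ^+ 2 * rho).
  by rewrite mulr_ge0// mulr_ge0// ltW.
rewrite -(ler_pXn2r (n := 2)) ?nnegrE ?sqrtr_ge0//.
rewrite sqr_sqrtr ?ler0n//.
have := sample_size_ge_sqr_rho; move: hd q0; move: (m%:R * alpha ^+ 2) => q hd q0 h.
(* Multiplying the two bounds gives [d <= 5600 * (q * rho) ^+ 2], and 5600 is below 75 squared. *)
have : d%:R / 8 * 1 <= q * (700 * (q * rho ^+ 2)).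
  by apply: ler_pM => //; rewrite ?divr_ge0 ?(ltW hd).
have -> : q * (700 * (q * rho ^+ 2)) = 700 * (q * rho) ^+ 2 by ring.
have -> : (75 * (q * rho)) ^+ 2 = 5625 * (q * rho) ^+ 2 by ring.
have := sqr_ge0 (q * rho); lra.
Qed.

End replicable_tester.

(** * Hypotheses on the tester as expectations over the randomness *)

Section expected_accept_prob.
Context (R : realType) d (T : measurableType d) dOm (Om : measurableType dOm).
Context (P : probability T R) (Q : probability Om R).
Variable A : {mfun (T * Om)%type >-> bool}.

Let a := accept_prob P A.

Let ia : Q.-integrable setT (EFin \o a).
Proof.
apply: integrable_unit; [exact: measurable_accept_prob|exact: accept_prob_itv].
Qed.

Let iaa : Q.-integrable setT (EFin \o (fun r => a r * (1 - a r))).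
Proof.
apply: integrable_unit => [|r].
  apply: measurable_funM; last apply: measurable_funB => //.
    exact: measurable_accept_prob.
  exact: measurable_accept_prob.
have /andP[a0 a1] := accept_prob_itv P A r; rewrite mulr_ge0 ?subr_ge0//=.
by rewrite mulr_ile1 ?subr_ge0// gerBl.
Qed.

Let icst (c : R) : Q.-integrable setT (EFin \o (fun=> c)).
Proof. exact: finite_measure_integrable_cst. Qed.

Let EE (f : Om -> R) : Q.-integrable setT (EFin \o f) ->
  (\int[Q]_r (f r)%:E = (\int[Q]_r f r)%:E)%E.
Proof. by move=> fi; rewrite /Rintegral fineK//; exact: integrable_fin_num. Qed.

Lemma expected_accept (c : R) :
  (c%:E <= (P \x Q) [set z | A z = true])%E -> c <= \int[Q]_r a r.
Proof. by rewrite prob_accept (EE ia) lee_fin. Qed.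

Lemma expected_reject (c : R) :
  (c%:E <= (P \x Q) [set z | A z = false])%E -> \int[Q]_r a r <= 1 - c.
Proof.
have i1a : Q.-integrable setT (EFin \o (fun r => 1 - a r)).
  rewrite (_ : _ \o _ = ((EFin \o (fun=> 1%R)) \- (EFin \o a))%E)//.
  by apply: integrableB => //; exact: icst.
have e : \int[Q]_r (1 - a r) = 1 - \int[Q]_r a r.
  rewrite -[in RHS](Rintegral_probability_cst Q 1).
  by apply: RintegralB => //; exact: icst.
by rewrite prob_reject (EE i1a) lee_fin e; lra.
Qed.

(** For fixed [r] the agreement probability is [a ^+ 2 + (1 - a) ^+ 2 = 1 - 2 * (a * (1 - a))]. *)
Lemma expected_disagreement (rho : R) :
  ((1 - rho)%:E <=
    ((P \x P) \x Q) [set z | A (z.1.1, z.2) = A (z.1.2, z.2)])%E ->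
  \int[Q]_r (a r * (1 - a r)) <= rho / 2.
Proof.
have i2 : Q.-integrable setT (EFin \o (fun r => 2 * (a r * (1 - a r)))).
  pose f r := a r * (1 - a r).
  rewrite (_ : _ \o _ = (fun r => 2%:E * (EFin \o f) r)%E)//.
  by apply: integrableZl => //; exact: iaa.
have i3 : Q.-integrable setT (EFin \o (fun r => 1 - 2 * (a r * (1 - a r)))).
  rewrite (_ : _ \o _ = ((EFin \o (fun=> 1%R)) \-
    (EFin \o (fun r => (2 * (a r * (1 - a r)))%R)))%E)//.
  by apply: integrableB => //; exact: icst.
have e : \int[Q]_r (1 - 2 * (a r * (1 - a r))) =
    1 - 2 * \int[Q]_r (a r * (1 - a r)).
  rewrite -[in RHS](RintegralZl _ _ iaa)//.
  rewrite -[X in X - _](Rintegral_probability_cst Q 1).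
  by apply: RintegralB => //; exact: icst.
rewrite prob_agree.
rewrite (eq_integral (fun r => (1 - 2 * (a r * (1 - a r)))%:E)); last first.
  by move=> r _; congr (_%:E); rewrite /a; move: (accept_prob P A r) => x; ring.
by rewrite (EE i3) lee_fin e; lra.
Qed.

End expected_accept_prob.

Theorem mainTheorem8 (R : realType) :
  exists2 c : R, 0 < c &
    forall (d m : nat) (alpha rho : R)
           (dOm : measure_display) (Om : measurableType dOm)
           (Q : probability Om R) (A : algorithm R d m Om bool),
      (0 < d)%N -> 0 < alpha -> 0 < rho ->
      replicable Q rho A ->
      ((99 / 100)%:E <= output_prob Q A (gaussian (origin R d)) accept)%E ->
      (forall mu : vec R d, alpha <= l2norm mu ->
        ((99 / 100)%:E <= output_prob Q A (gaussian mu) reject)%E) ->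
      c * (Num.sqrt d%:R / (alpha ^+ 2 * rho) + 1 / (alpha ^+ 2 * rho ^+ 2))
        <= m%:R.
Proof.
exists 1000^-1; first by rewrite invr_gt0 ltr0n.
move=> d m alpha rho dOm Om Q A d0 alpha0 rho0 hrep hacc hrej.
pose P (nu : vec R d) := iid_prob m (gaussian nu).
apply: (@sample_complexity R d m _ _ Q (fun nu => accept_prob (P nu) A) alpha rho).
- by move=> nu; exact: (measurable_accept_prob (P nu) A).
- by move=> r; exact: (cr_bounded_prob (measurable_accept_region A r)).
- by move=> nu; exact: (expected_disagreement (hrep (gaussian nu))).
- exact: (expected_accept hacc).
- move=> nu /hrej h; apply: le_trans (expected_reject h) _; lra.
- exact: d0.
- exact: alpha0.
- exact: rho0.
Qed.
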